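(* Let $\mathcal{R}$ be a rectangular domain of the basic hexagonal model consisting of $n$ cells, with given initial values $x(c,0),y(c,0)\in\mathbb{N}$ for every cell $c$. Suppose that at time $0$ all cells along the right boundary of $\mathcal{R}$ are on fire and all cells along the left boundary of $\mathcal{R}$ (the village) have to be protected. Let $Y$ be the maximum, over all cells $c\in\mathcal{R}$, of the sum of the $y(\cdot,0)$-values of the direct neighbours of $c$. Then the minimum integer $k$ for which a protecting path for $k$ exists can be found in time $O(n\log n\log Y)$.
   Context: Basic hexagonal model: the plane (here a rectangular region $\mathcal{R}$ of it) is partitioned into hexagonal cells; two cells are direct neighbours if they share an edge (only cells of $\mathcal{R}$ count). The state of cell $c$ at time $t\in\mathbb{N}$ is a pair of non-negative integers $x(c,t)$ (resistance against ignition) and $y(c,t)$ (remaining fuel). Cell $c$ is burning at time $t$ if $x(c,t)=0$ and $y(c,t)>0$; alive if $x(c,t)>0$ and $y(c,t)>0$; dead if $y(c,t)=0$. Transition from $t$ to $t+1$: if $c$ is alive at time $t$, then $x(c,t+1)=\max\{x(c,t)-b,0\}$ where $b$ is the number of direct neighbours of $c$ burning at time $t$; if $c$ is burning at time $t$, then $y(c,t+1)=y(c,t)-1$; all other values stay unchanged. A cell is ignited (catches fire) when its $x$-value becomes $0$; putting a cell on fire at time $0$ means setting its $x$-value to $0$ at time $0$. A separating path is a path of cells (consecutive cells are direct neighbours) in $\mathcal{R}$ connecting the lower boundary to the upper boundary of $\mathcal{R}$. A separating path $\pi$ is a protecting path for $k$ if increasing the initial $x$-value of every cell on $\pi$ by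 $k$ (leaving all other cells unchanged) ensures that, when the cells on the right boundary are put on fire at time $0$, the fire never ignites any cell of the village. Running times are measured in a model where arithmetic on the cell values takes constant time. *)

(* Defs.v *)
From mathcomp Require Import all_boot.
Set Implicit Arguments. Unset Strict Implicit. Unset Printing Implicit Defensive.

(* A cell is a pair (i, j) : row i < h, column j < w; n = h * w cells.      *)
(* Hexagons are laid out in "odd-r" offset coordinates: odd rows are        *)
(* shifted half a cell to the right.  Row 0 is the lower boundary, row h-1  *)
(* the upper boundary, column 0 the left boundary (village), column w-1 the *)
(* right boundary.                                                          *)

Definition cell := (nat * nat)%type.

Definition in_R (h w : nat) (c : cell) : bool := (c.1 < h) && (c.2 < w).

(* hexagonal adjacency (sharing an edge) in odd-r offset coordinates *)
Definition hexadj (c d : cell) : bool :=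
  let: (i, j) := c in let: (i', j') := d in
  ((i' == i) && ((j' == j.+1) || (j == j'.+1)))
  || (((i' == i.+1) || (i == i'.+1)) &&
      (if odd i then (j' == j) || (j' == j.+1) else (j' == j) || (j'.+1 == j))).

Definition adj (h w : nat) (c d : cell) : bool :=
  [&& in_R h w c, in_R h w d & hexadj c d].

(* a state assigns to every cell its pair (x, y) *)
Definition state := ((cell -> nat) * (cell -> nat))%type.

Definition burning (st : state) (c : cell) : bool := (st.1 c == 0) && (0 < st.2 c).
Definition alive (st : state) (c : cell) : bool := (0 < st.1 c) && (0 < st.2 c).

Definition nb_burning (h w : nat) (st : state) (c : cell) : nat :=
  \sum_(i < h) \sum_(j < w) (adj h w c (nat_of_ord i, nat_of_ord j)
                              && burning st (nat_of_ord i, nat_of_ord j)).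

Definition step (h w : nat) (st : state) : state :=
  (fun c => if alive st c then st.1 c - nb_burning h w st c else st.1 c,
   fun c => if burning st c then (st.2 c).-1 else st.2 c).

Definition separating_path (h w : nat) (p : seq cell) : Prop :=
  exists c0 p', p = c0 :: p' /\
    all (in_R h w) p /\ path (adj h w) c0 p' /\
    c0.1 = 0 /\ (last c0 p').1 = h.-1.

Definition init_state (h w : nat) (x0 y0 : nat -> nat -> nat) (k : nat)
    (p : seq cell) : state :=
  (fun c => if c.2 == w.-1 then 0 else x0 c.1 c.2 + (if c \in p then k else 0),
   fun c => y0 c.1 c.2).

Definition state_at (h w : nat) (x0 y0 : nat -> nat -> nat) (k : nat)
    (p : seq cell) (t : nat) : state :=
  iter t (step h w) (init_state h w x0 y0 k p).

Definition ignited (h w : nat) (x0 y0 : nat -> nat -> nat) (k : nat)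
    (p : seq cell) (c : cell) : Prop :=
  c.2 = w.-1 \/
  exists t, 0 < (state_at h w x0 y0 k p t).1 c /\
            (state_at h w x0 y0 k p t.+1).1 c = 0.

Definition protecting_path (h w : nat) (x0 y0 : nat -> nat -> nat) (k : nat)
    (p : seq cell) : Prop :=
  separating_path h w p /\
  forall i, i < h -> ~ ignited h w x0 y0 k p (i, 0).

Definition Ymax (h w : nat) (y0 : nat -> nat -> nat) : nat :=
  \max_(i < h) \max_(j < w)
     \sum_(i' < h) \sum_(j' < w)
        (if adj h w (nat_of_ord i, nat_of_ord j) (nat_of_ord i', nat_of_ord j')
         then y0 i' j' else 0).

(* Unit-cost RAM (arithmetic on values in constant time).                   *)
(* (No multiplication, to avoid the well-known excess power of unit-cost    *)
(* RAMs with multiplication.)                                               *)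

Inductive instr :=
| IConst (r v : nat)
| IAdd (r a b : nat)
| ISub (r a b : nat)
| IHalf (r a : nat)
| ILoad (r a : nat)
| IStore (a r : nat)
| IJz (a l : nat)
| IJmp (l : nat)
| IHalt.

Definition upd (m : nat -> nat) (a v : nat) : nat -> nat :=
  fun b => if b == a then v else m b.

(* exec p T pc m = Some m' iff, started at pc with memory m, the program
   reaches a Halt instruction (or leaves the program) within T steps,
   with final memory m' *)
Fixpoint exec (p : seq instr) (T pc : nat) (m : nat -> nat) : option (nat -> nat) :=
  match T with
  | 0 => None
  | T'.+1 =>
    match nth IHalt p pc with
    | IConst r v => exec p T' pc.+1 (upd m r v)
    | IAdd r a b => exec p T' pc.+1 (upd m r (m a + m b))
    | ISub r a b => exec p T' pc.+1 (upd m r (m a - m b))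
    | IHalf r a => exec p T' pc.+1 (upd m r (m a)./2)
    | ILoad r a => exec p T' pc.+1 (upd m r (m (m a)))
    | IStore a r => exec p T' pc.+1 (upd m (m a) (m r))
    | IJz a l => exec p T' (if m a == 0 then l else pc.+1) m
    | IJmp l => exec p T' l m
    | IHalt => Some m
    end
  end.

(* input encoding: m[0] = h, m[1] = w, and for the cell (i, j) with
   q = i * w + j: m[2 + 2q] = x(c,0), m[3 + 2q] = y(c,0); 0 elsewhere *)
Definition input (h w : nat) (x0 y0 : nat -> nat -> nat) : nat -> nat :=
  fun a =>
    if a == 0 then h else if a == 1 then w else
    let q := (a - 2)./2 in
    if q < h * w then
      (if odd a then y0 (q %/ w) (q %% w) else x0 (q %/ w) (q %% w))
    else 0.

(* Main.v *)
(* A separating path need not be simple, so for a given [k] the best one sweeps all cells, leaving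
   out only village cells that burn from the start. Whether it protects is decided by a flood fill:
   a cell catches fire exactly when the total fuel of its burning neighbours reaches its
   resistance, so the set of burnt cells is the least set closed under this rule, and a queue
   computes it in time O(n). Protection is monotone in [k] and certain beyond the total fuel, which
   is at most n Y, so bisection needs O(log n + log Y) rounds. As the input fills the low
   addresses, the machine first frees some registers by moving the input to a larger address. *)

Require Import Defs.
From mathcomp Require Import all_boot.
From mathcomp Require Import zify.
Set Implicit Arguments. Unset Strict Implicit. Unset Printing Implicit Defensive.

(** * Fire spread and protection *)

Section Region.
Variables h w : nat.

(** Timing can be discarded because a burning cell loses one unit of fuel in exactly those steps in
    which it takes one unit from each living neighbour. No least fixpoint is ever formed: the final
    queue is a certificate in both directions. Its order justifies each entry by the earlier ones,
    so all of it burns, also under any smaller resistances ([ignition_order]); no cell outside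
    receives enough from it, so nothing else burns ([fire_closed]). Comparing with the resistance
    raised by [k] on all cells, one rejected [k] refutes every path and every smaller value at once,
    which yields monotonicity. On the machine side there is no multiplication and hardly a free
    word: only [h], [w] and one parked word can serve as registers at first. Hence a block size is
    found by doubling [w] while [2 * h] is halved, [w] is later recovered by undoing the doublings,
    and scans run over whole blocks padded with zeros instead of [h * w] entries. The number of
    rounds is a sum of two logarithms; the stated bound has their product, which dominates because
    both factors carry a successor. *)

Definition cells : seq cell := [seq (i, j) | i <- iota 0 h, j <- iota 0 w].

Lemma mem_cells c : (c \in cells) = in_R h w c.
Proof.
rewrite /in_R; case: c => i j /=; apply/allpairsP/andP => [[[a b]]|[hi hj]].
  by rewrite !mem_iota /= !add0n => -[ha hb [-> ->]].
by exists (i, j); rewrite !mem_iota /= !add0n.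
Qed.

Lemma uniq_cells : uniq cells.
Proof. by apply: allpairs_uniq; rewrite ?iota_uniq // => -[a b] [c d] _ _ /= [-> ->]. Qed.

Lemma size_cells : size cells = h * w.
Proof. by rewrite size_allpairs !size_iota. Qed.

Lemma sum_cells (F : cell -> nat) :
  \sum_(i < h) \sum_(j < w) F (nat_of_ord i, nat_of_ord j) = \sum_(c <- cells) F c.
Proof.
rewrite /cells big_allpairs_dep -(big_mkord xpredT (fun i => \sum_(j < w) F (i, nat_of_ord j))).
rewrite /index_iota subn0; apply: eq_bigr => i _.
by rewrite -(big_mkord xpredT (fun j => F (i, j))) /index_iota subn0.
Qed.

Lemma sum_mem_cells (Q : seq cell) (P : pred cell) (F : cell -> nat) :
  uniq Q -> {subset Q <= cells} ->
  \sum_(d <- Q | P d) F d = \sum_(d <- cells | (d \in Q) && P d) F d.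
Proof.
move=> uQ sQ; rewrite big_mkcondr -[RHS]big_filter /= -big_mkcond.
apply: perm_big; apply: uniq_perm => //; first exact: filter_uniq uniq_cells.
by move=> d; rewrite mem_filter; case: (boolP (d \in Q)) => //= /sQ ->.
Qed.

Lemma adj_sym c d : adj h w c d = adj h w d c.
Proof.
rewrite /adj andbCA; do 2!congr (_ && _).
case: c d => [i j] [i' j'] /=.
by case oi: (odd i); case oi': (odd i'); apply/idP/idP; lia.
Qed.

Lemma adjP c d : adj h w c d -> in_R h w c /\ in_R h w d.
Proof. by case/and3P. Qed.

(** * Walks covering a prescribed set of cells *)

Section Walk.

(** Closed walks compose: two at the same cell concatenate, and one at a neighbour becomes a detour
    out and back. Only the set of visited cells counts, hence [=i]. *)
Definition tour (c : cell) (L : seq cell) :=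
  exists s, [/\ path (adj h w) c s, last c s = c & c :: s =i c :: L].

Lemma tour_nil c : tour c [::].
Proof. by exists [::]. Qed.

Lemma tour_cat c L1 L2 : tour c L1 -> tour c L2 -> tour c (L1 ++ L2).
Proof.
move=> [s1 [p1 l1 e1]] [s2 [p2 l2 e2]]; exists (s1 ++ s2); split.
- by rewrite cat_path p1 l1.
- by rewrite last_cat l1.
move=> d; have := e1 d; have := e2 d; rewrite !inE !mem_cat.
by case: (d == c) => //= -> ->.
Qed.

Lemma tour_cons c d L : adj h w c d -> tour d L -> tour c (d :: L).
Proof.
move=> cd [s [p l e]]; exists (d :: rcons s c); split.
- by rewrite /= cd rcons_path p l adj_sym.
- by rewrite /= last_rcons.
move=> b; have := e b; rewrite !inE mem_rcons inE.
by case: (b == c) => //= ->.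
Qed.

Lemma adj_up i j : i.+1 < h -> j < w -> adj h w (i, j) (i.+1, j).
Proof. rewrite /adj /in_R /= => hi hj; case: (odd i); lia. Qed.

Lemma adj_right i j : i < h -> j.+1 < w -> adj h w (i, j) (i, j.+1).
Proof. rewrite /adj /in_R /= => hi hj; lia. Qed.

Lemma tour_row i j n : i < h -> j + n < w ->
  tour (i, j) [seq (i, j') | j' <- iota j.+1 n].
Proof.
move=> hi; elim: n j => [|n IH] j hn; first exact: tour_nil.
by apply: tour_cons; [apply: adj_right; lia | apply: IH; lia].
Qed.

Variable a : pred nat.

Definition row_cells i : seq cell :=
  (if a i then [:: (i, 0)] else [::]) ++ [seq (i, j) | j <- iota 2 (w - 2)].

(** A comb with column 1 as its spine and the rows as teeth. Column 0 cannot be the spine, since [a]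
    may exclude some of its cells. A column is a path because [(i, j)] and [(i.+1, j)] touch for
    either parity of [i]. *)
Lemma tour_rows i n : 1 < w -> i + n < h ->
  exists2 L, tour (i, 1) L &
    forall c, (c \in (i, 1) :: L) =
      (i <= c.1 <= i + n) && (c.2 < w) && ((0 < c.2) || a c.1).
Proof.
move=> w1; elim: n i => [|n IH] i hn.
all: have T : tour (i, 1) (row_cells i).
1,3: apply: tour_cat; last (by apply: tour_row; lia).
1,2: case: (a i); last exact: tour_nil.
1,2: by apply: tour_cons; [rewrite adj_sym; apply: adj_right; lia | exact: tour_nil].
all: have R c : (c \in (i, 1) :: row_cells i) = (c.1 == i) && (c.2 < w) && ((0 < c.2) || a c.1).
1,3: case: c => k l; rewrite inE mem_cat /row_cells.
1,2: have -> : ((k, l) \in [seq (i, j) | j <- iota 2 (w - 2)]) = (k == i) && (2 <= l < w).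
1,3: apply/mapP/andP => [[j]|[/eqP -> hl]]; [rewrite mem_iota => hj [-> ->]; split; lia|].
1,2: by exists l => //; rewrite mem_iota; lia.
1,2: rewrite xpair_eqE /=; case: (eqVneq k i) => [->|ki] /=.
1,3: case: (a i); rewrite ?inE ?xpair_eqE /=; lia.
1,2: case: (a i); rewrite ?inE ?xpair_eqE /=; lia.
- by exists (row_cells i) => // c; rewrite R; lia.
have [L TL ML] := IH i.+1 ltac:(lia).
exists (row_cells i ++ (i.+1, 1) :: L).
  by apply: tour_cat => //; apply: tour_cons => //; apply: adj_up; lia.
by move=> c; rewrite -cat_cons mem_cat R ML; case: (a c.1); lia.
Qed.

Lemma path_up i n : 1 < w -> i + n < h ->
  exists s, [/\ path (adj h w) (i, 1) s, last (i, 1) s = (i + n, 1)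
     & all (fun c => (c.2 == 1) && (c.1 < h)) s].
Proof.
move=> w1; elim: n i => [|n IH] i hn; first by exists [::]; rewrite /= addn0.
have [s [p l b]] := IH i.+1 ltac:(lia).
exists ((i.+1, 1) :: s); split; rewrite /= ?p ?andbT ?l ?b ?andbT //.
- by apply: adj_up; lia.
- by rewrite addSnnS.
lia.
Qed.

(** The comb returns to row 0, so the walk then climbs column 1 to reach the upper boundary; this
    adds no cell. *)
Lemma separating_path_exists : 1 < w -> 0 < h ->
  exists2 p, separating_path h w p &
    forall c, (c \in p) = in_R h w c && ((0 < c.2) || a c.1).
Proof.
move=> w1 h0.
have [L [s [ps ls es]] ML] := @tour_rows 0 h.-1 w1 ltac:(lia).
have [u [pu lu bu]] := @path_up 0 h.-1 w1 ltac:(lia).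
have mem c : (c \in (0, 1) :: (s ++ u)) = in_R h w c && ((0 < c.2) || a c.1).
  rewrite -cat_cons mem_cat es ML /in_R; case: c => i j /=.
  case: (boolP ((i, j) \in u)) => [/(allP bu) /= /andP[/eqP -> hc]|_].
    by rewrite orbT hc w1.
  by rewrite orbF; case: (a i); lia.
exists ((0, 1) :: (s ++ u)) => //.
exists (0, 1), (s ++ u); split => //; split; last split; last split => //.
- by apply/allP => c; rewrite mem => /andP[].
- by rewrite cat_path ps ls.
by rewrite last_cat ls lu.
Qed.

End Walk.

(** * Fire spread without time *)

Section Fire.
Variables (x0 y0 : nat -> nat -> nat).

Definition dose (Q : seq cell) (c : cell) : nat := \sum_(d <- Q | adj h w c d) y0 d.1 d.2.

Lemma dose_rcons Q d c :
  dose (rcons Q d) c = dose Q c + (if adj h w c d then y0 d.1 d.2 else 0).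
Proof. by rewrite /dose -cats1 big_cat big_cons big_nil /=; case: ifP; rewrite ?addn0. Qed.

Variables (k : nat) (p : seq cell).

Let st := state_at h w x0 y0 k p.
Let X c := (st 0).1 c.

Definition burnt_fuel t c := \sum_(d <- cells | adj h w c d) (y0 d.1 d.2 - (st t).2 d).

Lemma state_atS t : st t.+1 = step h w (st t).
Proof. by []. Qed.

Lemma fuel_anti t c : (st t.+1).2 c <= (st t).2 c.
Proof. by rewrite state_atS /=; case: ifP => // _; lia. Qed.

Lemma fuel_le t n c : (st (t + n)).2 c <= (st t).2 c.
Proof. by elim: n => [|n IH]; rewrite ?addn0 // addnS (leq_trans (fuel_anti _ _)). Qed.

Lemma resist_anti t c : (st t.+1).1 c <= (st t).1 c.
Proof. by rewrite state_atS /=; case: ifP => // _; lia. Qed.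

Lemma resist_le t n c : (st (t + n)).1 c <= (st t).1 c.
Proof. by elim: n => [|n IH]; rewrite ?addn0 // addnS (leq_trans (resist_anti _ _)). Qed.

Lemma fuel_const t c : 0 < (st t).1 c -> (st t).2 c = y0 c.1 c.2.
Proof.
elim: t => [//|t IH] Hx.
have Hx' : 0 < (st t).1 c by apply: leq_trans Hx (resist_anti _ _).
by rewrite state_atS /= /burning -IH //; case: eqP => // E; rewrite E in Hx'.
Qed.

Lemma burnt_out t c : (st t).1 c = 0 -> exists n, (st (t + n)).2 c = 0.
Proof.
move=> Hx; exists ((st t).2 c).
have H n : (st (t + n)).2 c <= (st t).2 c - n.
  elim: n => [|n IH]; first by rewrite addn0 subn0.
  have Z : (st (t + n)).1 c = 0 by have := resist_le t n c; lia.
  by rewrite addnS state_atS /= /burning Z eqxx /=; case: ifP; lia.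
by have := H ((st t).2 c); lia.
Qed.

Lemma nb_burningE t c :
  nb_burning h w (st t) c = \sum_(d <- cells | adj h w c d) burning (st t) d.
Proof.
rewrite /nb_burning (sum_cells (fun d => (adj h w c d && burning (st t) d) : nat)).
by rewrite [RHS]big_mkcond; apply: eq_bigr => d _; case: (adj h w c d).
Qed.

Lemma fuel_le0 t c : (st t).2 c <= y0 c.1 c.2.
Proof. exact: (fuel_le 0 t c). Qed.

Lemma burnt_fuelS t c : burnt_fuel t.+1 c = burnt_fuel t c + nb_burning h w (st t) c.
Proof.
rewrite nb_burningE /burnt_fuel -big_split; apply: eq_bigr => d _ /=.
have := fuel_le0 t d; rewrite {1}/burning.
rewrite /burning; case: eqP => /= _; case: ltnP => /=; lia.
Qed.

(** While its resistance is positive, the cell keeps all its fuel, so it is alive and feels every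
    burning neighbour; once it is 0, truncated subtraction absorbs the rest. A dead cell would keep
    its resistance, hence the hypothesis. *)
Lemma resistE t c : 0 < y0 c.1 c.2 -> (st t).1 c = X c - burnt_fuel t c.
Proof.
move=> yc0; elim: t => [|t IH].
  by rewrite /burnt_fuel big1 ?subn0 // => d _; rewrite /st /= subnn.
rewrite state_atS /= burnt_fuelS subnDA -IH /alive.
by case: (posnP ((st t).1 c)) => [->//|Hx]; rewrite /= fuel_const // yc0.
Qed.

Lemma burnt_fuel_lower t Q c : uniq Q -> all (in_R h w) Q ->
  (forall d, d \in Q -> (st t).2 d = 0) -> dose Q c <= burnt_fuel t c.
Proof.
move=> uQ /allP RQ Q0; rewrite /dose (sum_mem_cells _ _ uQ); last first.
  by move=> d /RQ; rewrite mem_cells.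
rewrite /burnt_fuel [leqLHS]big_mkcond [leqRHS]big_mkcond leq_sum // => d _.
by case: (boolP (d \in Q)) => //= /Q0 ->; rewrite subn0.
Qed.

Lemma burnt_fuel_upper t Q c : uniq Q -> all (in_R h w) Q ->
  (forall d, in_R h w d -> d \notin Q -> (st t).2 d = y0 d.1 d.2) ->
  burnt_fuel t c <= dose Q c.
Proof.
move=> uQ /allP RQ Q0; rewrite /dose (sum_mem_cells _ _ uQ); last first.
  by move=> d /RQ; rewrite mem_cells.
rewrite /burnt_fuel [leqLHS]big_mkcond [leqRHS]big_mkcond leq_sum // => d _.
case: (boolP (d \in Q)) => //= dQ; first by case: ifP; rewrite ?leq_subr.
case: ifP => // /adjP[_ Rd]; rewrite Q0 ?subnn //.
Qed.

(** A derivation that [Q] burns: each entry is ignited by the fuel of those before it. The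
    resistance is a parameter so that one derivation serves all smaller resistances. *)
Definition ignition_order (Z : cell -> nat) (Q : seq cell) :=
  forall i, i < size Q -> Z (nth (0, 0) Q i) <= dose (take i Q) (nth (0, 0) Q i).

Definition fire_closed (Z : cell -> nat) (Q : seq cell) :=
  forall c, in_R h w c -> c \notin Q -> dose Q c < Z c.

(** Induction on prefixes of [Q]: when the first [n] cells have burnt out, the next one has lost all
    its resistance and burns out in turn. *)
Lemma ignition_order_burns Z Q c : uniq Q -> all (in_R h w) Q ->
  ignition_order Z Q -> (forall d, in_R h w d -> X d <= Z d) ->
  c \in Q -> 0 < y0 c.1 c.2 -> exists t, (st t).1 c = 0.
Proof.
move=> uQ RQ oQ XZ cQ yc0.
have H n : n <= size Q -> exists t, forall d, d \in take n Q -> (st t).2 d = 0.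
  elim: n => [|n IH] hn; first by exists 0; rewrite take0.
  have [t Ht] := IH (ltnW hn); set e := nth (0, 0) Q n.
  have [n' Hn'] : exists n', (st (t + n')).2 e = 0.
    case: (posnP (y0 e.1 e.2)) => [y00|ype].
      by exists 0; have := fuel_le0 (t + 0) e; lia.
    apply: burnt_out; rewrite resistE //.
    have RQ' : all (in_R h w) (take n Q) by apply/allP => d /mem_take /(allP RQ).
    have := burnt_fuel_lower e (take_uniq n uQ) RQ' Ht.
    have /leq_trans /(_ (oQ n hn)) := XZ e (allP RQ _ (mem_nth (0, 0) hn)).
    by rewrite -/e => /leq_trans H /H /eqP.
  exists (t + n') => d; rewrite (take_nth (0, 0) hn) mem_rcons inE => /predU1P[->//|/Ht E].
  by have := fuel_le t n' d; rewrite E; lia.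
have [t Ht] := H _ (leqnn _); exists t.
(* Positive resistance would mean untouched fuel, but [c] has burnt out. *)
case: (posnP ((st t).1 c)) => // Hx.
by move: (fuel_const Hx) yc0 (Ht c); rewrite take_size => -> /prednK <- /(_ cQ).
Qed.

(** Induction on time: as long as no fuelled cell outside [Q] has been ignited, only fuel of [Q] has
    been consumed, which is too little for any cell outside. *)
Lemma fire_closed_safe Q t c : uniq Q -> all (in_R h w) Q -> fire_closed X Q ->
  in_R h w c -> c \notin Q -> 0 < y0 c.1 c.2 -> 0 < (st t).1 c.
Proof.
move=> uQ RQ cQ; elim: t c => [|t IH] c Rc cNQ yc0.
  by have := cQ c Rc cNQ; rewrite /X; lia.
rewrite resistE // subn_gt0; apply: leq_ltn_trans (cQ c Rc cNQ).
apply: burnt_fuel_upper => // d Rd dNQ.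
case: (posnP (y0 d.1 d.2)) => [y00|yd0]; first by have := fuel_le0 t.+1 d; lia.
have Hx := IH d Rd dNQ yd0.
by rewrite state_atS /= /burning (fuel_const Hx) eqn0Ngt Hx.
Qed.

Lemma ignition_time c t : 0 < X c -> (st t).1 c = 0 ->
  exists t', 0 < (st t').1 c /\ (st t'.+1).1 c = 0.
Proof.
move=> X0; elim: t => [|t IH] Ht; first by rewrite /X Ht in X0.
by case: (posnP ((st t).1 c)) => [/IH//|Hx]; exists t.
Qed.

Lemma no_fuel_const c t : y0 c.1 c.2 = 0 -> (st t).1 c = X c.
Proof.
move=> y00; elim: t => [//|t IH]; rewrite state_atS /= /alive.
by have := fuel_le0 t c; rewrite y00 leqn0 => /eqP ->; rewrite andbF.
Qed.

End Fire.

(** * Deciding protection for a given [k] *)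

Section Protection.
Variables (x0 y0 : nat -> nat -> nat).
Hypotheses (h0 : 0 < h) (w1 : 1 < w).

Definition full_resist (k : nat) (c : cell) := if c.2 == w.-1 then 0 else x0 c.1 c.2 + k.

(* A village cell with [x0 = 0] can never be "ignited", since its resistance does not drop to 0. *)
Definition ignitable (c : cell) := [&& c.2 == 0, 0 < x0 c.1 c.2 & 0 < y0 c.1 c.2].

Definition protectable k := exists p, protecting_path h w x0 y0 k p.

(** Whatever the path and [k' <= k], the initial resistances lie below [full_resist k], so one
    ignition order refutes them all. *)
Lemma unprotectable Q k k' : uniq Q -> all (in_R h w) Q ->
  ignition_order y0 (full_resist k) Q -> has ignitable Q -> k' <= k -> ~ protectable k'.
Proof.
move=> uQ RQ oQ /hasP[[i j] cQ /and3P[/= /eqP j0 xp yp]] kk [p [_ Hp]].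
subst j; have /andP[/= hi _] := allP RQ _ cQ.
case: (Hp i hi); right.
have [|t Ht] := @ignition_order_burns x0 y0 k' p _ Q (i, 0) uQ RQ oQ _ cQ yp.
  by move=> d _; rewrite /= /full_resist; case: eqP => // _; case: ifP; lia.
apply: ignition_time Ht => /=.
(* As [1 < w], the village cell is not set on fire at time 0; it starts positive and reaching 0 is a
   genuine drop. *)
by have -> : (0 == w.-1) = false; lia.
Qed.

(* Village cells that start burning and lie in [Q] are left out of the path:
   strengthening them would only allow them to be ignited. *)
Lemma protectableP Q k : uniq Q -> all (in_R h w) Q ->
  fire_closed y0 (full_resist k) Q -> ~~ has ignitable Q -> protectable k.
Proof.
move=> uQ RQ cQ /hasPn nQ.
have [p sp mp] := separating_path_exists
  (fun i => ~~ ((x0 i 0 == 0) && ((i, 0) \in Q))) w1 h0.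
exists p; split => // i hi.
have wF : (0 == w.-1) = false by lia.
case=> [/= /eqP|[t [Hx Hx']]]; first by rewrite wF.
have R0 : in_R h w (i, 0) by rewrite /in_R /=; lia.
(* Closedness only concerns cells outside [Q], and all left-out cells are in [Q]; elsewhere the path
   gives the full resistance. *)
have cl : fire_closed y0 (state_at h w x0 y0 k p 0).1 Q.
  move=> [a b] Rc cNQ; have := cQ _ Rc cNQ; rewrite /full_resist /= mp Rc /=.
  case: ifP => // _; case: (posnP b) => //= b0; subst b.
  by rewrite (negbTE cNQ) andbF.
case: (posnP (y0 i 0)) => [yi0|yip].
  have E t' := @no_fuel_const x0 y0 k p (i, 0) t' yi0.
  by move: Hx; rewrite E -(E t.+1) Hx'.
case: (boolP ((i, 0) \in Q)) => [iQ|iNQ]; last first.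
  by have := @fire_closed_safe x0 y0 k p Q t.+1 (i, 0) uQ RQ cl R0 iNQ yip; rewrite Hx'.
have := nQ _ iQ; rewrite /ignitable /= yip andbT -eqn0Ngt => xi0.
have X0 : (state_at h w x0 y0 k p 0).1 (i, 0) = 0.
  by rewrite /= wF mp R0 /= iQ andbT (eqP xi0) eqxx.
by have := resist_le x0 y0 k p 0 t (i, 0); rewrite add0n X0 leqNgt Hx.
Qed.

Definition total_fuel := \sum_(c <- cells) y0 c.1 c.2.

Lemma dose_le_total Q c : uniq Q -> all (in_R h w) Q -> dose y0 Q c <= total_fuel.
Proof.
move=> uQ /allP RQ; rewrite /dose (sum_mem_cells _ _ uQ); last first.
  by move=> d /RQ; rewrite mem_cells.
by rewrite big_mkcond leq_sum // => d _; case: ifP.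
Qed.

(** Ignition happens already at equality, hence the successor. With this value the right column
    alone is closed. *)
Lemma protectable_total : protectable total_fuel.+1.
Proof.
pose Q := [seq c <- cells | c.2 == w.-1].
have uQ : uniq Q by apply: filter_uniq uniq_cells.
have RQ : all (in_R h w) Q.
  by apply/allP => c; rewrite mem_filter mem_cells => /andP[].
apply: (protectableP uQ RQ).
  move=> c Rc; rewrite mem_filter mem_cells Rc andbT /full_resist => /negbTE ->.
  by have := dose_le_total c uQ RQ; lia.
apply/hasPn => c; rewrite mem_filter /ignitable => /andP[/eqP -> _].
by have -> : (w.-1 == 0) = false; lia.
Qed.

Lemma fuel_le_Ymax c : in_R h w c -> y0 c.1 c.2 <= Ymax h w y0.
Proof.
move=> Rc.
(* As [1 < w], some cell of the same row touches [c]; the sum over the neighbours of that cell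
   includes the fuel of [c]. *)
have [d dc] : exists d, adj h w d c.
  case: c Rc => i j /andP[/= hi hj]; case: (posnP j) => [->|jp].
    by exists (i, 1); rewrite adj_sym adj_right.
  by exists (i, j.-1); rewrite -{2}(prednK jp); apply: adj_right; lia.
have [/andP[hi hj] _] := adjP dc.
rewrite /Ymax.
apply: leq_trans (leq_bigmax (Ordinal hi)).
apply: leq_trans (leq_bigmax (Ordinal hj)).
rewrite (sum_cells (fun e => if adj h w (d.1, d.2) e then y0 e.1 e.2 else 0)).
rewrite (bigD1_seq c) ?mem_cells ?uniq_cells //= -surjective_pairing dc.
exact: leq_addr.
Qed.

Lemma total_fuel_le : total_fuel <= h * w * Ymax h w y0.
Proof.
have -> : h * w * Ymax h w y0 = \sum_(c <- cells) Ymax h w y0.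
  by rewrite big_const_seq iter_addn_0 count_predT size_cells mulnC.
by rewrite /total_fuel big_seq [leqRHS]big_seq leq_sum // => c; rewrite mem_cells; apply: fuel_le_Ymax.
Qed.

End Protection.
End Region.

(** * A structured language over the RAM *)

Inductive cmd :=
| Blk of seq instr
| Seq of cmd & cmd
| IfNZ of nat & cmd & cmd
| While of seq instr & nat & cmd.

Fixpoint csize (c : cmd) : nat :=
  match c with
  | Blk l => size l
  | Seq c1 c2 => csize c1 + csize c2
  | IfNZ r c1 c2 => (csize c1 + csize c2).+2
  | While pre r c => (size pre + csize c).+2
  end.

(** Jump targets are absolute, so the address [b] of the first instruction is needed. *)
Fixpoint compile (c : cmd) (b : nat) : seq instr :=
  match c with
  | Blk l => l
  | Seq c1 c2 => compile c1 b ++ compile c2 (b + csize c1)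
  | IfNZ r c1 c2 =>
      IJz r (b + csize c1).+2 :: compile c1 b.+1 ++
      IJmp (b + csize c1 + csize c2).+2 :: compile c2 (b + csize c1).+2
  | While pre r c =>
      pre ++ IJz r (b + size pre + csize c).+2 ::
      compile c (b + size pre).+1 ++ [:: IJmp b]
  end.

Lemma size_compile c b : size (compile c b) = csize c.
Proof.
elim: c b => [l|c1 IH1 c2 IH2|r c1 IH1 c2 IH2|pre r c IH] b //=.
- by rewrite size_cat IH1 IH2.
- by rewrite size_cat /= IH1 IH2 addnS.
- by rewrite size_cat /= size_cat IH /= addn1 !addnS.
Qed.

Definition straight (i : instr) :=
  match i with IJz _ _ | IJmp _ | IHalt => false | _ => true end.

Definition effect (m : nat -> nat) (i : instr) : nat -> nat :=
  match i with
  | IConst r v => upd m r v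
  | IAdd r a b => upd m r (m a + m b)
  | ISub r a b => upd m r (m a - m b)
  | IHalf r a => upd m r (m a)./2
  | ILoad r a => upd m r (m (m a))
  | IStore a r => upd m (m a) (m r)
  | _ => m
  end.

Inductive run : cmd -> (nat -> nat) -> (nat -> nat) -> nat -> Prop :=
| RunBlk l m : all straight l -> run (Blk l) m (foldl effect m l) (size l)
| RunSeq c1 c2 m m1 m2 t1 t2 :
    run c1 m m1 t1 -> run c2 m1 m2 t2 -> run (Seq c1 c2) m m2 (t1 + t2)
| RunThen r c1 c2 m m' t : m r != 0 -> run c1 m m' t -> run (IfNZ r c1 c2) m m' t.+2
| RunElse r c1 c2 m m' t : m r = 0 -> run c2 m m' t -> run (IfNZ r c1 c2) m m' t.+1
| RunStop pre r c m : all straight pre -> foldl effect m pre r = 0 ->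
    run (While pre r c) m (foldl effect m pre) (size pre).+1
| RunLoop pre r c m m1 m2 t1 t2 : all straight pre -> foldl effect m pre r != 0 ->
    run c (foldl effect m pre) m1 t1 -> run (While pre r c) m1 m2 t2 ->
    run (While pre r c) m m2 (size pre + t1 + t2).+2.

Lemma nth_IHalt_cat P1 i P2 : nth IHalt (P1 ++ i :: P2) (size P1) = i.
Proof. by rewrite nth_cat ltnn subnn. Qed.

Lemma exec_straight p b P1 l P2 T m : p = P1 ++ l ++ P2 -> b = size P1 -> all straight l ->
  exec p (size l + T) b m = exec p T (b + size l) (foldl effect m l).
Proof.
move=> + ->; elim: l P1 m => [|i l IH] P1 m E; first by rewrite addn0.
case/andP=> si sl; have := IH (rcons P1 i) (effect m i).
rewrite cat_rcons size_rcons addSnnS => /(_ E sl) /= <-.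
by rewrite E nth_IHalt_cat; case: i {E} si.
Qed.

Lemma exec_jz p b P1 r l P2 T m : p = P1 ++ IJz r l :: P2 -> b = size P1 ->
  exec p T.+1 b m = exec p T (if m r == 0 then l else b.+1) m.
Proof. by move=> -> -> /=; rewrite nth_IHalt_cat. Qed.

Lemma exec_jmp p b P1 l P2 T m : p = P1 ++ IJmp l :: P2 -> b = size P1 ->
  exec p T.+1 b m = exec p T l m.
Proof. by move=> -> -> /=; rewrite nth_IHalt_cat. Qed.

(** Keeping the surrounding code and the remaining time [T] arbitrary lets the claim chain through
    sequences and loops, before any halt is reached. *)
Lemma exec_compile c m m' t : run c m m' t -> forall p b P1 P2 T,
  p = P1 ++ compile c b ++ P2 -> b = size P1 ->
  exec p (t + T) b m = exec p T (b + csize c) m'.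
Proof.
elim=> {c m m' t}.
- by move=> l m sl p b P1 P2 T E Eb; apply: exec_straight E Eb sl.
- move=> c1 c2 m m1 m2 t1 t2 _ IH1 _ IH2 p b P1 P2 T /=; rewrite -catA => E Eb.
  rewrite -addnA (IH1 _ _ _ _ _ E Eb) addnA.
  apply: (IH2 _ _ (P1 ++ compile c1 b) P2); first by rewrite E catA.
  by rewrite size_cat size_compile Eb.
- move=> r c1 c2 m m' t mr _ IH p b P1 P2 T E Eb; rewrite [compile _ _]/= -?catA ?cat_cons -?catA ?cat_cons in E; rewrite [csize _]/=.
  have -> : t.+2 + T = (t + T.+1).+1 by lia.
  rewrite (exec_jz _ _ E Eb) (negbTE mr).
  rewrite (IH _ _ (rcons P1 (IJz r (b + csize c1).+2)) (IJmp (b + csize c1 + csize c2).+2 ::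
    compile c2 (b + csize c1).+2 ++ P2)); last 2 first.
  + by rewrite E cat_rcons.
  + by rewrite size_rcons Eb.
  rewrite (exec_jmp (P1 := rcons P1 (IJz r (b + csize c1).+2) ++ compile c1 b.+1)
    (l := (b + csize c1 + csize c2).+2) (P2 := compile c2 (b + csize c1).+2 ++ P2)).
  + by congr exec; lia.
  + by rewrite E -catA cat_rcons.
  by rewrite size_cat size_rcons size_compile Eb.
- move=> r c1 c2 m m' t mr _ IH p b P1 P2 T E Eb; rewrite [compile _ _]/= -?catA ?cat_cons -?catA ?cat_cons in E; rewrite [csize _]/=.
  rewrite addSn (exec_jz _ _ E Eb) mr eqxx.
  have -> : b + (csize c1 + csize c2).+2 = (b + csize c1).+2 + csize c2 by lia.
  apply: (IH _ _ (P1 ++ (IJz r (b + csize c1).+2 :: rcons (compile c1 b.+1)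
    (IJmp (b + csize c1 + csize c2).+2))) P2).
    by rewrite E -catA /= cat_rcons.
  by rewrite size_cat /= size_rcons size_compile Eb !addnS.
- move=> pre r c m sp m0 p b P1 P2 T E Eb; rewrite [compile _ _]/= -?catA ?cat_cons -?catA ?cat_cons in E; rewrite [csize _]/=.
  rewrite addSnnS (exec_straight _ _ E Eb sp) (exec_jz (P1 := P1 ++ pre)
    (r := r) (l := (b + size pre + csize c).+2)
    (P2 := compile c (b + size pre).+1 ++ IJmp b :: P2)).
  + by rewrite m0 eqxx; congr exec; lia.
  + by rewrite E !catA.
  by rewrite size_cat Eb.
- move=> pre r c m m1 m2 t1 t2 sp m0 _ IH1 _ IH2 p b P1 P2 T E' Eb; rewrite [csize _]/=.
  have E := E'; rewrite [compile _ _]/= -?catA ?cat_cons -?catA ?cat_cons in E.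
  have -> : (size pre + t1 + t2).+2 + T = size pre + (t1 + (t2 + T).+1).+1 by lia.
  rewrite (exec_straight _ _ E Eb sp) (exec_jz (P1 := P1 ++ pre)
    (r := r) (l := (b + size pre + csize c).+2)
    (P2 := compile c (b + size pre).+1 ++ IJmp b :: P2)); last 2 first.
  + by rewrite E catA.
  + by rewrite size_cat Eb.
  rewrite (negbTE m0) (IH1 _ _ (P1 ++ rcons pre (IJz r (b + size pre + csize c).+2))
    (IJmp b :: P2)); last 2 first.
  + by rewrite E -!catA cat_rcons.
  + by rewrite size_cat size_rcons Eb addnS.
  rewrite (exec_jmp (P1 := P1 ++ pre ++ IJz r (b + size pre + csize c).+2 ::
    compile c (b + size pre).+1) (l := b) (P2 := P2)).
  + exact: (IH2 _ _ P1 P2).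
  + by rewrite E -!catA.
  by rewrite !size_cat /= size_compile Eb; lia.
Qed.

Lemma exec_run c m m' t : run c m m' t -> exec (compile c 0) t.+1 0 m = Some m'.
Proof.
move=> R; rewrite -addn1 (exec_compile R (P1 := [::]) (P2 := [::])) //=; last by rewrite cats0.
(* The extra time unit pays for the default [IHalt] found just past the code. *)
by rewrite nth_default // size_compile.
Qed.

(* A memory seen as a list of registers (the addresses below the length of the list)
   and a heap; the heap values below that length are junk. *)
Definition view := (seq nat * (nat -> nat))%type.

Definition flat (s : view) : nat -> nat :=
  fun a => if a < size s.1 then nth 0 s.1 a else s.2 a.

(** Indirect accesses must lie beyond the registers. This rules out aliasing, so that a block is
    evaluated by computation on a literal list. *)
Fixpoint wp (l : seq instr) (rho : seq nat) (H : nat -> nat)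
    (K : seq nat -> (nat -> nat) -> Prop) : Prop :=
  match l with
  | [::] => K rho H
  | i :: l' =>
    match i with
    | IConst r v => wp l' (set_nth 0 rho r v) H K
    | IAdd r a b => wp l' (set_nth 0 rho r (nth 0 rho a + nth 0 rho b)) H K
    | ISub r a b => wp l' (set_nth 0 rho r (nth 0 rho a - nth 0 rho b)) H K
    | IHalf r a => wp l' (set_nth 0 rho r (nth 0 rho a)./2) H K
    | ILoad r a => size rho <= nth 0 rho a /\ wp l' (set_nth 0 rho r (H (nth 0 rho a))) H K
    | IStore a r => size rho <= nth 0 rho a /\ wp l' rho (upd H (nth 0 rho a) (nth 0 rho r)) K
    | _ => False
    end
  end.

Definition regs_of (i : instr) : seq nat :=
  match i with
  | IConst r _ => [:: r]
  | IAdd r a b | ISub r a b => [:: r; a; b]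
  | IHalf r a | ILoad r a | IStore a r => [:: r; a]
  | _ => [::]
  end.

Definition in_regs (n : nat) (l : seq instr) := all (fun i => all (ltn^~ n) (regs_of i)) l.

Lemma flat_reg rho H a : a < size rho -> flat (rho, H) a = nth 0 rho a.
Proof. by rewrite /flat /= => ->. Qed.

Lemma flat_heap rho H a : size rho <= a -> flat (rho, H) a = H a.
Proof. by rewrite /flat /= ltnNge => ->. Qed.

Lemma flat_set_nth rho H r v : r < size rho ->
  upd (flat (rho, H)) r v =1 flat (set_nth 0 rho r v, H).
Proof.
move=> hr a; rewrite /upd /flat /= size_set_nth (maxn_idPr hr) nth_set_nth /=.
by case: eqP => [->|//]; rewrite hr.
Qed.

Lemma flat_upd rho H b v : size rho <= b ->
  upd (flat (rho, H)) b v =1 flat (rho, upd H b v).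
Proof.
move=> hb a; rewrite /upd /flat /=; case: eqP => [->|//].
by rewrite ltnNge hb.
Qed.

Lemma upd_ext m m' a v : m =1 m' -> upd m a v =1 upd m' a v.
Proof. by move=> E b; rewrite /upd; case: eqP. Qed.

Lemma wp_sound l rho H K m : in_regs (size rho) l -> m =1 flat (rho, H) ->
  wp l rho H K -> all straight l /\
  exists rho' H', [/\ foldl effect m l =1 flat (rho', H'), size rho' = size rho & K rho' H'].
Proof.
elim: l rho H m => [|i l IH] rho H m /=; first by move=> _ E KK; split => //; exists rho, H.
case/andP=> ri rl E.
have S r v m' : r < size rho -> m' =1 upd (flat (rho, H)) r v ->
  wp l (set_nth 0 rho r v) H K -> all straight l /\
  exists rho' H', [/\ foldl effect m' l =1 flat (rho', H'), size rho' = size rho & K rho' H'].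
  move=> hr E' W.
  have sz : size (set_nth 0 rho r v) = size rho by rewrite size_set_nth; lia.
  by rewrite -sz; apply: IH W; rewrite ?sz // => a; rewrite E' flat_set_nth.
case: i ri => //= [r v|r a b|r a b|r a|r a|a r].
- by move=> /andP[hr _]; apply: S => //; apply: upd_ext.
- by move=> /and4P[hr ha hb _]; apply: S => //; rewrite !E !flat_reg //; apply: upd_ext.
- by move=> /and4P[hr ha hb _]; apply: S => //; rewrite !E !flat_reg //; apply: upd_ext.
- by move=> /and3P[hr ha _]; apply: S => //; rewrite !E !flat_reg //; apply: upd_ext.
- move=> /and3P[hr ha _] [hh]; apply: S => //; rewrite !E (flat_reg _ ha).
  by rewrite flat_heap //; apply: upd_ext.
- move=> /and3P[hr ha _] [hh]; apply: IH => // b.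
  by rewrite -(flat_upd _ _ hh) !E !flat_reg //; apply: upd_ext.
Qed.

(** Total correctness, with the number of steps handed to the postcondition so that costs add up.
    Ranging over all [m] pointwise equal to the view avoids functional extensionality. *)
Definition terminates n (c : cmd) rho H (Q : nat -> seq nat -> (nat -> nat) -> Prop) :=
  size rho = n -> forall m, m =1 flat (rho, H) -> exists m' t rho' H',
    [/\ run c m m' t, m' =1 flat (rho', H'), size rho' = n & Q t rho' H'].

Lemma term_blk n l rho H Q : in_regs n l ->
  wp l rho H (Q (size l)) -> terminates n (Blk l) rho H Q.
Proof.
move=> rl W sz m E; rewrite -sz in rl.
have [sl [rho' [H' [E' sz' KK]]]] := wp_sound rl E W.
by exists (foldl effect m l), (size l), rho', H'; split; rewrite ?sz'//; constructor.
Qed.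

Lemma term_seq n c1 c2 rho H Q :
  terminates n c1 rho H (fun t1 rho1 H1 =>
    terminates n c2 rho1 H1 (fun t2 => Q (t1 + t2))) ->
  terminates n (Seq c1 c2) rho H Q.
Proof.
move=> W sz m E; have [m1 [t1 [rho1 [H1 [R1 E1 sz1 W2]]]]] := W sz m E.
have [m2 [t2 [rho2 [H2 [R2 E2 sz2 K2]]]]] := W2 sz1 m1 E1.
by exists m2, (t1 + t2), rho2, H2; split => //; apply: RunSeq R1 R2.
Qed.

Lemma term_if n r c1 c2 rho H Q : r < n ->
  (nth 0 rho r != 0 -> terminates n c1 rho H (fun t => Q t.+2)) ->
  (nth 0 rho r = 0 -> terminates n c2 rho H (fun t => Q t.+1)) ->
  terminates n (IfNZ r c1 c2) rho H Q.
Proof.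
move=> hr W1 W2 sz m E.
have mr : m r = nth 0 rho r by rewrite E flat_reg // sz.
case: (eqVneq (nth 0 rho r) 0) => r0.
  have [m' [t [rho' [H' [R E' sz' K]]]]] := W2 r0 sz m E.
  by exists m', t.+1, rho', H'; split => //; apply: RunElse; rewrite ?mr.
have [m' [t [rho' [H' [R E' sz' K]]]]] := W1 r0 sz m E.
by exists m', t.+2, rho', H'; split => //; apply: RunThen; rewrite ?mr.
Qed.

Lemma term_weaken n c rho H (Q Q' : nat -> seq nat -> (nat -> nat) -> Prop) :
  terminates n c rho H Q -> (forall t rho' H', Q t rho' H' -> Q' t rho' H') ->
  terminates n c rho H Q'.
Proof.
move=> W QQ sz m E; have [m' [t [rho' [H' [R E' sz' K]]]]] := W sz m E.
by exists m', t, rho', H'; split => //; apply: QQ.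
Qed.

(* [I k] is the invariant with at most [k] further iterations to go. *)
Lemma term_while n pre r c (I : nat -> seq nat -> (nat -> nat) -> Prop) B k rho H Q :
  r < n -> in_regs n pre ->
  (forall k rho H, I k rho H -> wp pre rho H (fun rho1 H1 =>
     (nth 0 rho1 r = 0 -> Q rho1 H1) /\
     (nth 0 rho1 r != 0 -> 0 < k /\
        terminates n c rho1 H1 (fun t rho2 H2 => t <= B /\ I k.-1 rho2 H2)))) ->
  I k rho H ->
  terminates n (While pre r c) rho H (fun t rho' H' =>
    t <= (size pre + B).+2 * k.+1 /\ Q rho' H').
Proof.
move=> hr hp W; elim: k rho H => [|k IH] rho H Ik sz m E.
all: move: (hp); rewrite -{1}sz => hp'.
all: have [sp [rho1 [H1 [E1 sz1 [W1 W2]]]]] := wp_sound hp' E (W _ _ _ Ik).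
all: have mr : foldl effect m pre r = nth 0 rho1 r by rewrite E1 flat_reg // sz1 sz.
all: case: (eqVneq (nth 0 rho1 r) 0) => r0.
1,3: exists (foldl effect m pre), (size pre).+1, rho1, H1; split; rewrite ?sz1 //.
1,3: by apply: RunStop; rewrite ?mr.
1,2: by split; [lia | apply: W1].
- by have [] := W2 r0.
have [_ T] := W2 r0; rewrite sz in sz1.
have [m2 [t2 [rho2 [H2 [R2 E2 sz2 [tB I2]]]]]] := T sz1 _ E1.
have [m3 [t3 [rho3 [H3 [R3 E3 sz3 [tB' Q3]]]]]] := IH _ _ I2 sz2 _ E2.
exists m3, (size pre + t2 + t3).+2, rho3, H3; split => //.
  by apply: RunLoop R2 R3; rewrite ?mr.
by split => //; lia.
Qed.

(** * Memory layout and flood fill *)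

Section Layout.
Variables h w : nat.

(* Shearing the rows makes the six neighbours sit at the offsets 1, w + 1, w + 2 in
   both directions; the gaps between rows keep the borders apart. *)
Definition slot (c : cell) := w + 2 + c.1 * w.+1 + uphalf c.1 + c.2.

Arguments slot : simpl never.

(** Rows at distance two or more are further apart than the largest offset [w + 2], so an offset can
    only reach an adjacent row. *)
Lemma slot_row_lt n i j i' j' : j < w -> i' = i + 2 + n ->
  slot (i, j) + w + 2 < slot (i', j').
Proof.
move=> hj ->; rewrite /slot /= !mulnDl.
have : uphalf i <= uphalf (i + 2 + n) by rewrite uphalf_leq //; lia.
lia.
Qed.

(** The extra 1 after even rows cancels the hexagonal shift: the neighbours above are columns
    [j - 1], [j] for even [i] and [j], [j + 1] for odd [i], in both cases at the offsets [w + 1],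
    [w + 2]. *)
Lemma slot_up i j : slot (i.+1, j) = slot (i, j) + w + 1 + ~~ odd i.
Proof. by rewrite /slot /= uphalfE -[in RHS]addn1 /=; have := uphalf_half i; lia. Qed.

Lemma slot_inj c d : in_R h w c -> in_R h w d -> slot c = slot d -> c = d.
Proof.
case: c d => [i j] [i' j'] /andP[/= hi hj] /andP[/= hi' hj'].
case: (ltngtP i i') => ii E.
- have [E1|[n E1]] : i' = i.+1 \/ exists n, i' = i + 2 + n.
    by case: (eqVneq i' i.+1) => [|N]; [left | right; exists (i' - i - 2); lia].
  + by move: E; rewrite E1 slot_up /slot /=; case: (odd i) => /=; lia.
  by have := slot_row_lt j' hj E1; lia.
- have [E1|[n E1]] : i = i'.+1 \/ exists n, i = i' + 2 + n.
    by case: (eqVneq i i'.+1) => [|N]; [left | right; exists (i - i' - 2); lia].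
  + by move: E; rewrite E1 slot_up /slot /=; case: (odd i') => /=; lia.
  by have := slot_row_lt j hj' E1; lia.
by subst i'; congr (_, _); move: E; rewrite /slot /=; lia.
Qed.

Definition nbr_slots g := [:: g + 1; g - 1; g + w.+1; g - w.+1; g + w.+2; g - w.+2].

(** A count rather than membership, because the flood subtracts fuel once per offset: a neighbour
    must be hit exactly once. *)
Lemma count_nbr_slots c d : in_R h w c -> in_R h w d ->
  count (pred1 (slot c)) (nbr_slots (slot d)) = adj h w c d.
Proof.
move=> Rc Rd; rewrite /adj Rc Rd andTb andTb.
case: c d Rc Rd => [i j] [i' j'] /andP[/= hi hj] /andP[/= hi' hj'].
have L i0 j0 : w + 2 <= slot (i0, j0) by rewrite /slot /=; lia.
move: (L i j) (L i' j') => L1 L2.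
rewrite /nbr_slots /=.
have F (x y : nat) : x <> y -> (x == y) = false by move/eqP/negbTE.
case: (ltngtP i i') => ii.
- have [E1|[n E1]] : i' = i.+1 \/ exists n, i' = i + 2 + n.
    by case: (eqVneq i' i.+1) => [|N]; [left | right; exists (i' - i - 2); lia].
  + have E2 : slot (i', j') + j = slot (i, j) + w + 1 + ~~ odd i + j'.
      by rewrite E1 slot_up /slot /=; lia.
    rewrite E1 eqxx -E1; move: (slot (i, j)) (slot (i', j')) L1 L2 E2 => s s' L1 L2 E2.
    rewrite !(F (s' + _) s) ?(F (s' - 1) s); try lia.
    have -> : (s' - w.+1 == s) = (j' + ~~ odd i == j) by apply/eqP/eqP; lia.
    have -> : (s' - w.+2 == s) = (j' + ~~ odd i == j.+1) by apply/eqP/eqP; lia.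
    by case: (odd i) => /=; lia.
  have := slot_row_lt j' hj E1.
  have -> : (i' == i.+1) = false by lia.
  have -> : (i == i'.+1) = false by lia.
  move: (slot (i, j)) (slot (i', j')) L1 L2 => s s' L1 L2 E2.
  by rewrite !(F (s' + _) s) ?(F (s' - _) s) //=; lia.
- have [E1|[n E1]] : i = i'.+1 \/ exists n, i = i' + 2 + n.
    by case: (eqVneq i i'.+1) => [|N]; [left | right; exists (i - i' - 2); lia].
  + have E2 : slot (i, j) + j' = slot (i', j') + w + 1 + ~~ odd i' + j.
      by rewrite E1 slot_up /slot /=; lia.
    have -> : odd i = ~~ odd i' by rewrite E1.
    have -> : (i == i'.+1) = true by lia.
    rewrite orbT /=; move: (slot (i, j)) (slot (i', j')) L1 L2 E2 => s s' L1 L2 E2.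
    rewrite !(F (s' - _) s) ?(F (s' + 1) s); try lia.
    have -> : (s' + w.+1 == s) = (j + ~~ odd i' == j') by apply/eqP/eqP; lia.
    have -> : (s' + w.+2 == s) = (j + ~~ odd i' == j'.+1) by apply/eqP/eqP; lia.
    by case: (odd i') => /=; lia.
  have := slot_row_lt j hj' E1.
  have -> : (i' == i.+1) = false by lia.
  have -> : (i == i'.+1) = false by lia.
  move: (slot (i, j)) (slot (i', j')) L1 L2 => s s' L1 L2 E2.
  by rewrite !(F (s' + _) s) ?(F (s' - _) s) //=; lia.
subst i'; have E2  : slot (i, j) + j' = slot (i, j') + j by rewrite /slot /=; lia.
have -> : (i == i.+1) = false by lia.
move: (slot (i, j)) (slot (i, j')) L1 L2 E2 => s s' L1 L2 E2 /=; rewrite orbF.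
have -> : (s' + 1 == s) = (j == j'.+1) by apply/eqP/eqP; lia.
have -> : (s' - 1 == s) = (j' == j.+1) by apply/eqP/eqP; lia.
rewrite !(F (s' + _.+1) s) ?(F (s' - _.+1) s); try lia.
Qed.

End Layout.

Definition skip := Blk [::].

(** A zero word means either a gap or a cell already queued; both are skipped, so no border test is
    needed and every cell enters the queue at most once. *)
Definition relax (up : bool) (ro : nat) : cmd :=
  Seq (Blk [:: if up then IAdd 18 21 ro else ISub 18 21 ro; ILoad 19 18])
      (IfNZ 19
         (Seq (Blk [:: ISub 19 19 20; IStore 18 19])
              (IfNZ 19 skip (Blk [:: IStore 16 18; IAdd 16 16 4])))
         skip).

Definition relaxes (l : seq (bool * nat)) : cmd :=
  foldr (fun x => Seq (relax x.1 x.2)) skip l.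

Definition flood_body : cmd :=
  Seq (Blk [:: ILoad 21 17; IAdd 17 17 4; IAdd 18 21 3; ILoad 20 18;
              IAdd 18 18 3; ILoad 18 18; IAdd 10 10 18])
  (relaxes [:: (true, 4); (false, 4); (true, 5); (false, 5); (true, 6); (false, 6)]).

(* With truncated subtraction, [1 - j - (1 - x) - (1 - y)] (register 21) is nonzero exactly when
   [j = 0], [0 < x] and [0 < y]. Register 15 alternates between 4 and 0, which shears the rows. *)
Definition init_body : cmd :=
  Seq (Blk [:: ILoad 18 13; IAdd 13 13 3; ILoad 20 13; IAdd 13 13 3;
              ISub 19 2 12; ISub 21 3 19; ISub 19 3 18; ISub 21 21 19;
              ISub 19 3 20; ISub 21 21 19; IAdd 18 18 9; ISub 12 12 3])
  (Seq (IfNZ 12 skip (Blk [:: IAdd 18 23 23]))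
  (Seq (Blk [:: IStore 14 18; IAdd 19 14 3; IStore 19 20; IAdd 19 19 3; IStore 19 21])
  (Seq (IfNZ 18 skip (Blk [:: IStore 16 14; IAdd 16 16 4]))
  (Seq (Blk [:: IAdd 14 14 4])
       (IfNZ 12 skip (Blk [:: IAdd 12 2 23; IAdd 14 14 4; IAdd 14 14 15;
                             ISub 15 4 15; ISub 11 11 3])))))).

Definition test_prog : cmd :=
  Seq (Blk [:: IAdd 11 0 23; IAdd 12 2 23; IConst 13 2; IAdd 13 13 1; IAdd 14 22 6;
              IAdd 15 4 23; IAdd 16 24 23; IAdd 10 23 23])
  (Seq (While [::] 11 init_body)
  (Seq (Blk [:: IAdd 17 24 23])
       (While [:: ISub 18 16 17] 18 flood_body))).

Section Program.
Variables (h w : nat) (x0 y0 : nat -> nat -> nat) (P : nat).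

Local Notation cell_in := (in_R h w).

(** Bisection uses [lo], [s] (length of the search interval) and [k] (value under test); [bad] adds
    up the flags of burnt cells; [i], [j] count down rows and columns; [d] and [y] are the address
    and fuel of the cell being processed, [a] and [b] scratch. *)
Definition frame lo s k bad i j src dst par tail head a b y d : seq nat :=
  [:: h; P; w; 1; 4; 4 * w.+1; 4 * w.+2; lo; s; k; bad; i; j; src; dst; par;
      tail; head; a; b; y; d; 2 * P; 0; 2 * P + 3].

(* Slot [g] occupies four words from [2 * P + 4 * g] on: the remaining resistance (0 in the gaps
   between rows), the fuel, the [ignitable] flag, and the queue entry number [g]. *)
Definition adr (c : cell) := 2 * P + 4 * slot w c.

(** Resistances of the right column are exempt: they are replaced by 0 anyway, and the word of its
    lower corner has been overwritten. *)
Definition input_copied (H : nat -> nat) := forall i j, i < h -> j < w ->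
  (j.+1 != w -> H (P + 2 + 2 * (i * w + j)) = x0 i j) /\
  H (P + 3 + 2 * (i * w + j)) = y0 i j.

Definition gaps_clear (H : nat -> nat) := forall g,
  (forall c, cell_in c -> slot w c != g) -> H (2 * P + 4 * g) = 0.

Definition cell_record (H : nat -> nat) (X S : cell -> nat) c :=
  [/\ H (adr c) = X c - S c, H (adr c + 1) = y0 c.1 c.2
    & (H (adr c + 2) != 0) = ignitable x0 y0 c].

(* [stored] are the cells whose record is up to date, [listed] those whose presence in the
   queue [Q] is decided; [S] is the dose received so far. *)
Record fire_inv (stored listed : pred cell) (X S : cell -> nat) (Q : seq cell)
    (H : nat -> nat) : Prop := FireInv {
  fi_input : input_copied H;
  fi_gaps : gaps_clear H;
  fi_cell : forall c, cell_in c -> stored c -> cell_record H X S c;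
  fi_queue : forall q, q < size Q -> H (2 * P + 3 + 4 * q) = adr (nth (0, 0) Q q);
  fi_uniq : uniq Q;
  fi_in : all cell_in Q;
  fi_sub : all listed Q;
  fi_mem : forall c, cell_in c -> listed c -> (c \in Q) = (X c <= S c);
  fi_order : ignition_order h w y0 X Q;
  fi_dose : forall c, cell_in c -> S c <= dose h w y0 Q c }.

Lemma upd_neq H a v b : b <> a -> upd H a v b = H b.
Proof. by rewrite /upd => /eqP/negbTE ->. Qed.

Lemma upd_eq H a v : upd H a v a = v.
Proof. by rewrite /upd eqxx. Qed.

Lemma adr_inj c d : cell_in c -> cell_in d -> adr c = adr d -> c = d.
Proof. by move=> Rc Rd E; apply: (slot_inj Rc Rd); move: E; rewrite /adr; lia. Qed.

Lemma cell_index_lt i j : i < h -> j < w -> i * w + j < h * w.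
Proof. by move=> hi hj; apply: leq_trans (leq_mul hi (leqnn w)); rewrite mulSn; lia. Qed.

Lemma gaps_clear_cell H c v : cell_in c -> gaps_clear H -> gaps_clear (upd H (adr c) v).
Proof.
move=> Rc G g Hg; rewrite upd_neq ?G //; have := Hg c Rc; rewrite /adr; lia.
Qed.

Lemma gaps_clear_field H g f v : 0 < f < 4 -> gaps_clear H ->
  gaps_clear (upd H (2 * P + 4 * g + f) v).
Proof. by move=> hf G g' Hg; rewrite upd_neq ?G //; lia. Qed.

Lemma cell_record_queue H q v X S c : cell_record H X S c ->
  cell_record (upd H (2 * P + 3 + 4 * q) v) X S c.
Proof. by case=> E1 E2 E3; split; rewrite upd_neq // /adr; lia. Qed.

Lemma ignition_order_rcons X Q c : ignition_order h w y0 X Q ->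
  X c <= dose h w y0 Q c -> ignition_order h w y0 X (rcons Q c).
Proof.
move=> oQ Xc i; rewrite size_rcons ltnS leq_eqVlt => /predU1P[->|hi].
  by rewrite nth_rcons ltnn eqxx -cats1 take_size_cat.
by rewrite nth_rcons hi -cats1 takel_cat ?oQ // ltnW.
Qed.

Lemma fire_inv_keep stored listed X S Q H c :
  fire_inv stored listed X S Q H -> ~~ listed c -> S c < X c ->
  fire_inv stored [pred e | listed e || (e == c)] X S Q H.
Proof.
case=> I G C Qu U R L M O D Lc Xc; split => //.
  by apply/allP => e /(allP L) /= ->.
move=> e Re /=; case: (eqVneq e c) => [->|_]; last by rewrite orbF; apply: M.
rewrite leqNgt Xc => _; apply/negbTE; apply: contra Lc => /(allP L) //.
Qed.

Lemma fire_inv_ext (stored listed stored' listed' : pred cell) X (S S' : cell -> nat) Q H :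
  (forall c, cell_in c -> stored' c -> stored c) ->
  (forall c, cell_in c -> listed' c = listed c) ->
  (forall c, cell_in c -> S' c = S c) ->
  fire_inv stored listed X S Q H -> fire_inv stored' listed' X S' Q H.
Proof.
move=> ss ll SS [I G C Qu U R L M O D]; split => //.
- by move=> c Rc /(ss _ Rc) /(C _ Rc); rewrite /cell_record SS.
- by apply/allP => e eQ; rewrite ll ?(allP L) // (allP R).
- by move=> c Rc; rewrite ll // SS //; apply: M.
- by move=> c Rc; rewrite SS //; apply: D.
Qed.

Hypothesis P_input : 2 * (h * w) + 2 <= P.

Lemma input_copied_upd H a v : 2 * P <= a -> input_copied H -> input_copied (upd H a v).
Proof.
move=> ha IH i j hi hj; have := cell_index_lt hi hj; have [Hx Hy] := IH i j hi hj.
by move=> L; split=> [/Hx E|]; rewrite upd_neq //; lia.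
Qed.

Lemma fire_inv_push stored listed X S Q H c :
  fire_inv stored listed X S Q H -> cell_in c -> ~~ listed c -> X c <= S c ->
  fire_inv stored [pred e | listed e || (e == c)] X S (rcons Q c)
    (upd H (2 * P + 3 + 4 * size Q) (adr c)).
Proof.
case=> I G C Qu U R L M O D Rc Lc Xc; split.
- by apply: input_copied_upd => //; lia.
- have -> : 2 * P + 3 + 4 * size Q = 2 * P + 4 * size Q + 3 by lia.
  exact: gaps_clear_field.
- by move=> e Re Se; apply: cell_record_queue; apply: C.
- move=> q; rewrite size_rcons ltnS leq_eqVlt => /predU1P[->|hq].
    by rewrite upd_eq nth_rcons ltnn eqxx.
  by rewrite upd_neq ?nth_rcons ?hq ?Qu //; lia.
- by rewrite rcons_uniq U andbT; apply: contra Lc => /(allP L).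
- by rewrite all_rcons Rc.
- by rewrite all_rcons /= eqxx orbT /=; apply/allP => e /(allP L) /= ->.
- move=> e Re; rewrite mem_rcons in_cons /=; case: (eqVneq e c) => [->|_] /=; first by rewrite Xc.
  by rewrite orbF; apply: M.
- by apply: ignition_order_rcons => //; apply: leq_trans Xc (D _ Rc).
- by move=> e Re; rewrite dose_rcons (leq_trans (D _ Re)) ?leq_addr.
Qed.

Section Relax.
Hypothesis P_big : 64 <= P.
Variables (X : cell -> nat) (lo s k bad i j src dst par head y d : nat).

Local Notation flood_frame := (fun tail a b => frame lo s k bad i j src dst par tail head a b y d).

Lemma relax_correct up ro g S Q H a b : ro \in [:: 4; 5; 6] ->
  (if up then addn else subn) d (nth 0 [:: 0; 0; 0; 0; 4; 4 * w.+1; 4 * w.+2] ro) = 2 * P + 4 * g ->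
  fire_inv predT predT X S Q H ->
  let S' e := S e + (slot w e == g) * y in
  (forall e, cell_in e -> S' e <= dose h w y0 Q e) ->
  terminates 25 (relax up ro) (flood_frame (2 * P + 3 + 4 * size Q) a b) H
    (fun t rho H' => t <= 12 /\ exists a b Q2,
       rho = flood_frame (2 * P + 3 + 4 * size (Q ++ Q2)) a b /\
       fire_inv predT predT X S' (Q ++ Q2) H').
Proof.
move=> hro hg FI S' DS'; apply: term_seq; apply: term_blk.
  by move: hro; rewrite !inE => /or3P[]/eqP->; case: up {hg}.
have -> K : wp [:: if up then IAdd 18 21 ro else ISub 18 21 ro; ILoad 19 18]
    (flood_frame (2 * P + 3 + 4 * size Q) a b) H K =
  (25 <= 2 * P + 4 * g /\
   K (flood_frame (2 * P + 3 + 4 * size Q) (2 * P + 4 * g) (H (2 * P + 4 * g))) H).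
  by rewrite -hg; move: hro; rewrite !inE => /or3P[]/eqP->; case: up {hg}.
split; first lia.
have sl : 2 * P + 4 * g >= 25 by lia.
set tgt := 2 * P + 4 * g in sl *.
apply: term_if => //= r0; last first.
  apply: term_blk => //=; split => //.
  exists tgt, (H tgt), [::]; rewrite cats0; split => //.
  (* If a cell sits at the zero word, it has already been ignited; a further dose changes neither
     its truncated difference nor its membership in [Q]. *)
  have Sg e : cell_in e -> slot w e = g -> X e <= S e.
    move=> Re Eg; have [E _ _] := fi_cell FI Re isT.
    by move: E; rewrite /adr Eg -/tgt r0; lia.
  case: (FI) => I G C Qu U R L M O D; split => //.
  - move=> c Rc _; have [E1 E2 E3] := C c Rc isT; split => //.
    by rewrite E1 /S'; case: eqP => [/(Sg _ Rc)|]; lia.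
  - move=> c Rc _; rewrite M // /S'; case: eqP => [/(Sg _ Rc)|]; lia.
have [c Rc Eg] : exists2 c, cell_in c & slot w c = g.
  case: (boolP (has (fun c => slot w c == g) (cells h w))) => [/hasP[c]|/hasPn N].
    by rewrite mem_cells => Rc /eqP <-; exists c.
  by move: r0; rewrite (fi_gaps FI) // => c Rc; apply: N; rewrite mem_cells.
have Et : tgt = adr c by rewrite /adr Eg.
have [Er _ _] := fi_cell FI Rc isT; rewrite -Et in Er.
have Xc : S c < X c by move: r0; rewrite Er; lia.
(* After the write, [c] may have to be queued but is not yet; so its membership is left
   undecided. *)
have FI1 : fire_inv predT (predC1 c) X S' Q (upd H tgt (H tgt - y)).
  have cNQ : c \notin Q by rewrite (fi_mem FI) // -ltnNge.
  case: (FI) => I G C Qu U R L M O D; split => //.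
  - by apply: input_copied_upd => //; rewrite /tgt; lia.
  - by rewrite Et; apply: gaps_clear_cell.
  - move=> e Re _; have [E1 E2 E3] := C e Re isT.
    split; [|by rewrite upd_neq // /adr /tgt; lia|by rewrite upd_neq // /adr /tgt; lia].
    case: (eqVneq e c) => [->|ec].
      by rewrite -Et upd_eq Er /S' Eg eqxx; lia.
    rewrite upd_neq ?Et //; last by move/(adr_inj Re Rc)/eqP; rewrite (negbTE ec).
    rewrite E1 /S'; case: eqP => [E|]; last lia.
    by case/eqP: ec; apply: (slot_inj Re Rc); rewrite E Eg.
  - by move=> q hq; rewrite upd_neq ?Qu // /tgt; lia.
  - by apply/allP => e eQ /=; apply: contraNneq cNQ => <-.
  - move=> e Re /= ec; rewrite M // /S'; case: eqP => [E|]; last lia.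
    by case/eqP: ec; apply: (slot_inj Re Rc); rewrite E Eg.
have S'c : S' c = S c + y by rewrite /S' Eg eqxx mul1n.
apply: term_seq; apply: term_blk => //=; split => //.
apply: term_if => //= r1; apply: term_blk => //=.
- split => //; exists tgt, (H tgt - y), [::]; rewrite cats0; split => //.
  apply: fire_inv_ext (fire_inv_keep (c := c) FI1 _ _) => //=.
  + by move=> e _; case: (e == c).
  + by rewrite eqxx.
  by move: r1; rewrite Er S'c; lia.
split; first by lia.
split => //; exists tgt, (H tgt - y), [:: c]; split.
  by rewrite size_cat /= addn1 mulnS /frame; congr [:: _, _, _, _, _, _, _, _, _, _, _, _, _, _, _, _, _ & _]; lia.
have LC : ~~ predC1 c c by rewrite /= eqxx.
have XS : X c <= S' c by move: r1; rewrite Er S'c; lia.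
have := fire_inv_push FI1 Rc LC XS; rewrite -Et cats1.
by apply: fire_inv_ext => //= e _; case: (e == c).
Qed.

End Relax.
End Program.

(** * Correctness of the flood fill *)

Section Flood.
Variables (h w : nat) (x0 y0 : nat -> nat -> nat) (P : nat).
Variables (X : cell -> nat) (lo s k i j src dst par : nat).

Local Notation cell_in := (in_R h w).
Local Notation adr := (adr w P).
Local Notation inv := (fire_inv h w x0 y0 P predT predT X).
Local Notation queue_ptr n := (2 * P + 3 + 4 * n).
Local Notation flood_frame := (fun bad => frame h w P lo s k bad i j src dst par).

Definition relax_slot (g : nat) (x : bool * nat) :=
  (if x.1 then addn else subn) g (nth 0 [:: 0; 0; 0; 0; 1; w.+1; w.+2] x.2).

Lemma dose_cat Q Q2 c : dose h w y0 Q c <= dose h w y0 (Q ++ Q2) c.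
Proof. by rewrite /dose big_cat leq_addr. Qed.

Lemma slot_ge c : w.+2 <= slot w c.
Proof. by rewrite /slot; lia. Qed.

Hypotheses (P_input : 2 * (h * w) + 2 <= P) (P_big : 64 <= P).

(** The bound on [g] keeps the subtracted offsets from truncating; slots start at [w + 2] for this
    reason. *)
Lemma relaxes_correct bad head y g l S Q H a b : w.+2 <= g ->
  all (fun x => x.2 \in [:: 4; 5; 6]) l -> inv S Q H ->
  let S' e := S e + count (pred1 (slot w e)) (map (relax_slot g) l) * y in
  (forall e, cell_in e -> S' e <= dose h w y0 Q e) ->
  terminates 25 (relaxes l)
    (flood_frame bad (queue_ptr (size Q)) head a b y (2 * P + 4 * g)) H
    (fun t rho H' => t <= 12 * size l /\ exists a b Q2,
       rho = flood_frame bad (queue_ptr (size (Q ++ Q2))) head a b y (2 * P + 4 * g) /\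
       inv S' (Q ++ Q2) H').
Proof.
move=> hg; elim: l S Q H a b => [|[up ro] l IH] S Q H a b hl FI S' DS'.
  apply: term_blk => //=; split => //; exists a, b, [::]; rewrite cats0; split => //.
  by apply: fire_inv_ext FI => // c _; rewrite /S' /= addn0.
move: hl; rewrite [all _ _]/= => /andP[hro hl]; apply: term_seq.
have E : (if up then addn else subn) (2 * P + 4 * g)
    (nth 0 [:: 0; 0; 0; 0; 4; 4 * w.+1; 4 * w.+2] ro) = 2 * P + 4 * relax_slot g (up, ro).
  rewrite /relax_slot /=; move: hro; rewrite !inE /= => /or3P[]/eqP->; case: up {S' DS'} => /=; lia.
have CE e : S' e = S e + (slot w e == relax_slot g (up, ro)) * y +
    count (pred1 (slot w e)) (map (relax_slot g) l) * y.
  by rewrite /S' [count _ _]/= [_ == slot w e]eq_sym mulnDl addnA.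
have DS1 e : cell_in e -> S e + (slot w e == relax_slot g (up, ro)) * y <= dose h w y0 Q e.
  move=> Re; apply: leq_trans (DS' e Re); by rewrite CE leq_addr.
have T := @relax_correct h w x0 y0 P P_input P_big X lo s k bad i j src dst par head y _ up ro _ S Q H a b hro E FI DS1.
apply: (term_weaken T) => {T}.
move=> t rho H1 [ht [a1 [b1 [Q1 [-> FI1]]]]].
apply: term_weaken (IH _ _ _ a1 b1 hl FI1 _) _.
  move=> e Re; apply: leq_trans (dose_cat _ _ _); apply: leq_trans (DS' e Re).
  by rewrite CE.
move=> t2 rho2 H2 [ht2 [a2 [b2 [Q2 [-> FI2]]]]].
split; first by rewrite [size _]/= mulnS leq_add.
exists a2, b2, (Q1 ++ Q2); rewrite !catA; split => //.
by apply: fire_inv_ext FI2 => // e _; rewrite CE.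
Qed.

(** Only the first [m] entries have delivered their fuel. Entries are distinct cells, so [h * w - m]
    bounds the remaining iterations. *)
Definition flood_inv (n : nat) (rho : seq nat) (H : nat -> nat) :=
  exists m Q bad a b y d,
    [/\ rho = flood_frame bad (queue_ptr (size Q)) (queue_ptr m) a b y d,
        inv (dose h w y0 (take m Q)) Q H, m <= size Q, h * w - m <= n
      & (bad != 0) = has (ignitable x0 y0) (take m Q)].

Lemma flood_body_correct m Q bad a b y d H : m < size Q ->
  inv (dose h w y0 (take m Q)) Q H ->
  (bad != 0) = has (ignitable x0 y0) (take m Q) ->
  terminates 25 flood_body
    (flood_frame bad (queue_ptr (size Q)) (queue_ptr m) a b y d) H
    (fun t rho H' => t <= 100 /\ flood_inv (h * w - m.+1) rho H').
Proof.
move=> hm FI hbad; apply: term_seq; apply: term_blk => //.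
set c := nth (0, 0) Q m.
have Rc : cell_in c by apply: (allP (fi_in FI)); apply: mem_nth.
have [_ Ey Ef] := fi_cell FI Rc isT.
rewrite /= (fi_queue FI hm) -/c Ey.
have -> : adr c + 1 + 1 = adr c + 2 by lia.
split; first lia. split; first by rewrite /adr; lia.
split; first by rewrite /adr; lia.
have -> : queue_ptr m + 4 = queue_ptr m.+1 by lia.
have tQ : take m.+1 Q = rcons (take m Q) c by rewrite (take_nth (0, 0)).
have DQ e : cell_in e -> dose h w y0 (take m Q) e +
    count (pred1 (slot w e)) (map (relax_slot (slot w c))
      [:: (true, 4); (false, 4); (true, 5); (false, 5); (true, 6); (false, 6)]) * y0 c.1 c.2
    = dose h w y0 (take m.+1 Q) e.
  move=> Re; rewrite tQ dose_rcons -[map _ _]/(nbr_slots w (slot w c)) (@count_nbr_slots h w) //.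
  by case: adj; rewrite ?mul1n ?mul0n.
have := @relaxes_correct (bad + H (adr c + 2)) (queue_ptr m.+1) (y0 c.1 c.2) (slot w c)
  [:: (true, 4); (false, 4); (true, 5); (false, 5); (true, 6); (false, 6)]
  (dose h w y0 (take m Q)) Q H (H (adr c + 2)) b (slot_ge c) isT FI.
move=> /= T; apply: term_weaken (T _) _ => {T}.
  by move=> e Re; rewrite DQ // -{2}(cat_take_drop m.+1 Q) dose_cat.
move=> t rho H1 [ht [a1 [b1 [Q1 [-> FI1]]]]]; split; first by rewrite -[100]/(7 + 93); lia.
have tQ1 : take m.+1 (Q ++ Q1) = take m.+1 Q by rewrite takel_cat.
exists m.+1, (Q ++ Q1), (bad + H (adr c + 2)), a1, b1, (y0 c.1 c.2), (adr c); split => //.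
- by apply: fire_inv_ext FI1 => // e Re; rewrite tQ1 -DQ.
- by rewrite size_cat; lia.
by rewrite tQ1 tQ has_rcons -Ef -hbad addn_eq0 negb_and orbC.
Qed.

Lemma flood_correct Q bad a b y d H : inv (fun=> 0) Q H -> bad = 0 ->
  terminates 25 (While [:: ISub 18 16 17] 18 flood_body)
    (flood_frame bad (queue_ptr (size Q)) (queue_ptr 0) a b y d) H
    (fun t rho H' => t <= 103 * (h * w).+1 /\ exists Q bad tail head a b y d,
       [/\ rho = flood_frame bad tail head a b y d,
        inv (dose h w y0 Q) Q H'
      & (bad != 0) = has (ignitable x0 y0) Q]).
Proof.
move=> FI bad0; apply: (@term_while _ _ _ _ flood_inv 100) => //; last first.
  exists 0, Q, bad, a, b, y, d; rewrite take0 subn0 bad0; split => //.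
  by apply: fire_inv_ext FI => // c _; rewrite /dose big_nil.
move=> n rho H1 [m [Q1 [bad1 [a1 [b1 [y1 [d1 [-> FI1 hm hn hb]]]]]]]].
rewrite /=; split=> r0.
  (* With every entry processed, the dose received is [dose Q1], and [fi_mem] turns into closedness
     of the queue. *)
  have E : m = size Q1 by lia.
  rewrite E take_size in FI1 hb.
  by do 8 eexists; split; [reflexivity | exact: FI1 | exact: hb].
have mQ : m < size Q1 by lia.
have sQ : size Q1 <= h * w.
  rewrite -size_cells; apply: uniq_leq_size; first exact: fi_uniq FI1.
  by move=> c /(allP (fi_in FI1)); rewrite mem_cells.
split; first lia.
apply: term_weaken (@flood_body_correct m Q1 bad1 _ _ _ _ _ mQ FI1 hb) _.
move=> t rho2 H2 [ht [m2 [Q2 [bad2 [a2 [b2 [y2 [d2 [-> FI2 hm2 hn2 hb2]]]]]]]]].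
split => //; exists m2, Q2, bad2, a2, b2, y2, d2; split => //; lia.
Qed.

End Flood.

(* [simpl] is exponential on long blocks, as it does not share the nested [set_nth]. *)
Ltac wp_run :=
  match goal with |- wp _ _ ?H ?K =>
    let H' := fresh in let K' := fresh in let sz := fresh in
    set H' := H; set K' := K; set sz := @size cell;
    lazy beta iota delta [wp set_nth nth size frame]; subst H' K' sz; cbv beta
  end.

(** * Initialising the cell records for a given [k] *)

Section Init.
Variables (h w : nat) (x0 y0 : nat -> nat -> nat) (P : nat).
Hypotheses (h0 : 0 < h) (w1 : 1 < w) (P_big : 64 <= P) (P_input : 2 * (h * w) + 2 <= P).
Variables (lo s k bad : nat).

Local Notation cell_in := (in_R h w).
Local Notation adr := (adr w P).
Local Notation X := (full_resist w x0 k).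
Local Notation inv := (fun stored listed => fire_inv h w x0 y0 P stored listed X (fun=> 0)).
Local Notation queue_ptr n := (2 * P + 3 + 4 * n).
Local Notation frame := (frame h w P lo s k bad).

Definition before (i j : nat) : pred cell :=
  [pred c | (c.1 < i) || (c.1 == i) && (c.2 < j)].

Lemma beforeS i j c : before i j.+1 c = before i j c || (c == (i, j)).
Proof. by case: c => a b; rewrite /before /= xpair_eqE; lia. Qed.

Lemma store_record i j Q H f : cell_in (i, j) ->
  inv (before i j) (before i j) Q H -> (f != 0) = ignitable x0 y0 (i, j) ->
  inv (before i j.+1) (before i j) Q
    (upd (upd (upd H (adr (i, j)) (X (i, j))) (adr (i, j) + 1) (y0 i j)) (adr (i, j) + 2) f).
Proof.
move=> Rc [I G C Qu U R L M O D] hf; split => //.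
- by do 3! (apply: (input_copied_upd P_input); first by rewrite /adr; lia).
- apply: (@gaps_clear_field h w P _ (slot w (i, j)) 2) => //.
  apply: (@gaps_clear_field h w P _ (slot w (i, j)) 1) => //.
  exact: gaps_clear_cell.
- move=> c' Rc'; rewrite beforeS; case: (eqVneq c' (i, j)) => [->|cc] hc.
    split; rewrite ?upd_eq ?subn0 //.
      by rewrite 2?upd_neq ?upd_eq //; lia.
    by rewrite upd_neq ?upd_eq //; lia.
  rewrite orbF in hc; have [E1 E2 E3] := C _ Rc' hc.
  have N : slot w c' <> slot w (i, j) by move/(slot_inj Rc' Rc)/eqP; rewrite (negbTE cc).
  by split; rewrite !upd_neq // /adr; lia.
- by move=> q hq; rewrite !upd_neq ?Qu // /adr; lia.
Qed.

Lemma push_correct i j src dst par iv jv head b y d Q H : cell_in (i, j) -> dst = adr (i, j) ->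
  inv (before i j.+1) (before i j) Q H ->
  terminates 25 (IfNZ 18 skip (Blk [:: IStore 16 14; IAdd 16 16 4]))
    (frame iv jv src dst par (queue_ptr (size Q)) head (X (i, j)) b y d) H
    (fun t rho H' => t <= 4 /\ exists Q,
       rho = frame iv jv src dst par (queue_ptr (size Q)) head (X (i, j)) b y d /\
       inv (before i j.+1) (before i j.+1) Q H').
Proof.
move=> Rc -> FI; have NB : ~~ before i j (i, j) by rewrite /before /= ltnn eqxx ltnn.
apply: term_if => //= r0; apply: term_blk => //=.
  split => //; exists Q; split => //.
  have X0 : 0 < X (i, j) by lia.
  apply: fire_inv_ext (fire_inv_keep FI NB X0) => // c _; exact: beforeS.
split; first lia.
split => //; exists (rcons Q (i, j)); split.
  by rewrite size_rcons mulnS /frame; congr [:: _, _, _, _, _, _, _, _, _, _, _, _, _, _, _, _, _ & _]; lia.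
have X0 : X (i, j) <= 0 by lia.
apply: fire_inv_ext (fire_inv_push P_input FI Rc NB X0) => // c _; exact: beforeS.
Qed.

Definition init_inv (n : nat) (rho : seq nat) (H : nat -> nat) :=
  exists i j Q head a b y d,
    [/\ rho = frame (h - i) (w - j) (P + 2 + 2 * (i * w + j)) (adr (i, j)) (4 * ~~ odd i)
          (queue_ptr (size Q)) head a b y d,
        inv (before i j) (before i j) Q H, i <= h, j < w /\ (i = h -> j = 0)
      & h * w - (i * w + j) <= n].

Lemma adr_next i j : adr (i, j.+1) = adr (i, j) + 4.
Proof. by rewrite /adr /slot /=; lia. Qed.

(** One slot for the cell, one for the gap after the row, and after an even row one more for the
    shear. *)
Lemma adr_next_row i j : j.+1 = w -> adr (i.+1, 0) = adr (i, j) + 4 + 4 + 4 * ~~ odd i.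
Proof. by move=> E; rewrite /adr slot_up /slot /=; lia. Qed.

Lemma init_body_correct i j Q head a b y d H : i < h -> j < w ->
  inv (before i j) (before i j) Q H ->
  terminates 25 init_body
    (frame (h - i) (w - j) (P + 2 + 2 * (i * w + j)) (adr (i, j)) (4 * ~~ odd i)
          (queue_ptr (size Q)) head a b y d) H
    (fun t rho H' => t <= 50 /\ init_inv (h * w - (i * w + j).+1) rho H').
Proof.
move=> hi hj FI; apply: term_seq; apply: term_blk; first by [].
have Rc : cell_in (i, j) by rewrite /in_R /= hi hj.
have [Hx Hy] := fi_input FI hi hj.
set src := P + 2 + 2 * (i * w + j) in Hx *.
have Esrc : src + 1 = P + 3 + 2 * (i * w + j) by rewrite /src; lia.
wp_run; rewrite Esrc Hy; split; first by rewrite /src; lia.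
split; first lia.
set flag := 1 - _ - _ - _.
have hflag : (flag != 0) = ignitable x0 y0 (i, j).
  rewrite /flag /ignitable /=; have -> : w - (w - j) = j by lia.
  case: (posnP j) => [j0|jp]; last by lia.
  by rewrite Hx; lia.
have -> : w - j - 1 = w - j.+1 by lia.
have -> : P + 3 + 2 * (i * w + j) + 1 = P + 2 + 2 * (i * w + j.+1) by lia.
apply: term_seq.
set xk := H src + k; set b1 := 1 - y0 i j.
have T1 : terminates 25 (IfNZ 12 skip (Blk [:: IAdd 18 23 23]))
    (frame (h - i) (w - j.+1) (P + 2 + 2 * (i * w + j.+1)) (adr (i, j)) (4 * ~~ odd i)
      (queue_ptr (size Q)) head xk b1 (y0 i j) flag) H
    (fun t rho H' => t <= 3 /\ rho = frame (h - i) (w - j.+1) (P + 2 + 2 * (i * w + j.+1))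
      (adr (i, j)) (4 * ~~ odd i) (queue_ptr (size Q)) head (X (i, j)) b1 (y0 i j) flag /\ H' = H).
  apply: term_if => //= r0; apply: term_blk => //=; split => //; split => //.
    rewrite /full_resist /=; have -> : (j == w.-1) = false by lia.
    by rewrite /xk Hx //; lia.
  by rewrite /full_resist /=; have -> : (j == w.-1) by lia.
apply: (term_weaken T1) => t1 rho1 H1 [ht1 [-> ->]] {T1}.
apply: term_seq; apply: term_blk; first by [].
wp_run.
do 3! (split; first by rewrite /adr; lia).
have -> : adr (i, j) + 1 + 1 = adr (i, j) + 2 by lia.
have FI1 := store_record Rc FI hflag.
apply: term_seq.
have T2 := @push_correct i j (P + 2 + 2 * (i * w + j.+1)) _ (4 * ~~ odd i) (h - i) (w - j.+1)
  head (adr (i, j) + 2) (y0 i j) flag Q _ Rc (erefl _) FI1.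
apply: (term_weaken T2) => {T2} t2 rho2 H2 [ht2 [Q2 [-> FI2]]].
apply: term_seq; apply: term_blk => //=.
apply: term_if => //= r0; apply: term_blk => //=.
  split; first lia.
  exists i, j.+1, Q2, head, (X (i, j)), (adr (i, j) + 2), (y0 i j), flag.
  by split; rewrite ?adr_next //; [lia | split; lia | lia].
have jw : j.+1 = w by lia.
split; first lia.
exists i.+1, 0, Q2, head, (X (i, j)), (adr (i, j) + 2), (y0 i j), flag; split => //; last 2 first.
- by split => //; lia.
- by rewrite mulSn; lia.
- rewrite (adr_next_row i jw) /frame.
  have -> : h - i.+1 = h - i - 1 by lia.
  have -> : w - 0 = w + 0 by lia.
  have -> : P + 2 + 2 * (i.+1 * w + 0) = P + 2 + 2 * (i * w + j.+1) by rewrite mulSn; lia.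
  by have -> : 4 * ~~ odd i.+1 = 4 - 4 * ~~ odd i by rewrite /=; case: (odd i).
apply: fire_inv_ext FI2 => // c Rc'; rewrite /before /=; move: Rc' => /andP[]; lia.
Qed.

Lemma init_correct head a b y d H : input_copied h w x0 y0 P H -> gaps_clear h w P H ->
  terminates 25 (While [::] 11 init_body)
    (frame h w (P + 2) (adr (0, 0)) 4 (2 * P + 3) head a b y d) H
    (fun t rho H' => t <= 52 * (h * w).+1 /\ exists Q i j src dst par head a b y d,
       rho = frame i j src dst par (queue_ptr (size Q)) head a b y d /\
       inv predT predT Q H').
Proof.
move=> I G; apply: (@term_while _ _ _ _ init_inv 50) => //; last first.
  exists 0, 0, [::], head, a, b, y, d; split => //.
  - by rewrite !subn0 !addn0.
  - split => //; try by move=> c Rc; rewrite /before /= ltn0 andbF.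
  - by split => //; lia.
  by rewrite leq_subr.
move=> n rho H1 [i [j [Q [head1 [a1 [b1 [y1 [d1 [-> FI hi [hj ij] hn]]]]]]]]].
rewrite /=; split=> r0.
  have E : i = h by lia.
  rewrite E ij // in FI.
  exists Q; do 10 eexists; split; first reflexivity.
  apply: fire_inv_ext FI => // c /andP[hc _]; rewrite /before /= ?hc //.
have ih : i < h by lia.
have := cell_index_lt ih hj; split; first lia.
apply: (term_weaken (@init_body_correct i j Q head1 a1 b1 y1 d1 _ ih hj FI)) => t rho2 H2 [ht].
move=> [i2 [j2 [Q2 [head2 [a2 [b2 [y2 [d2 [-> FI2 hi2 hj2 hn2]]]]]]]]].
split => //; exists i2, j2, Q2, head2, a2, b2, y2, d2; split => //; lia.
Qed.

End Init.

(** * Bisection *)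

(** The minimum stays in the interval from [lo] to [lo + s]. Since [s <= 2 * s./2 + 1], the upper
    part starting at [k + 1] also fits into length [s./2], so both outcomes keep the same halved
    [s]. *)
Definition bisect : cmd :=
  While [::] 8 (Seq (Blk [:: IHalf 8 8; IAdd 9 7 8])
    (Seq test_prog (IfNZ 10 (Blk [:: IAdd 7 9 3]) skip))).

Section Bisection.
Variables (h w : nat) (x0 y0 : nat -> nat -> nat) (P : nat).
Hypotheses (h0 : 0 < h) (w1 : 1 < w) (P_big : 64 <= P) (P_input : 2 * (h * w) + 2 <= P).

Local Notation frame := (frame h w P).
Local Notation X := (full_resist w x0).

Lemma test_correct lo s k bad i j src dst par tail head a b y d H :
  input_copied h w x0 y0 P H -> gaps_clear h w P H ->
  terminates 25 test_prog (frame lo s k bad i j src dst par tail head a b y d) H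
    (fun t rho H' => t <= 170 * (h * w).+1 /\
      exists Q bad i j src dst par tail head a b y d,
       [/\ rho = frame lo s k bad i j src dst par tail head a b y d,
         fire_inv h w x0 y0 P predT predT (X k) (dose h w y0 Q) Q H'
       & (bad != 0) = has (ignitable x0 y0) Q]).
Proof.
move=> I G; apply: term_seq; apply: term_blk; first by [].
wp_run; rewrite !addn0 (addnC 2 P).
have -> : 2 * P + 4 * w.+2 = adr w P (0, 0) by rewrite /adr /slot /=; lia.
apply: term_seq.
have T1 := @init_correct h w x0 y0 P h0 w1 P_big P_input lo s k 0 head a b y d H I G.
apply: (term_weaken T1) => {T1} t1 rho1 H1.
move=> [ht1 [Q1 [i1 [j1 [src1 [dst1 [par1 [head1 [a1 [b1 [y1 [d1 [-> FI]]]]]]]]]]]]].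
apply: term_seq; apply: term_blk; first by [].
wp_run; rewrite !addn0.
have T2 := @flood_correct h w x0 y0 P (X k) lo s k i1 j1 src1 dst1 par1 P_input P_big Q1
  0 a1 b1 y1 d1 H1 FI (erefl _).
rewrite muln0 addn0 in T2.
apply: (term_weaken T2) => {T2} t2 rho2 H2.
move=> [ht2 [Q2 [bad2 [tail2 [head2 [a2 [b2 [y2 [d2 [-> FI2 hb]]]]]]]]]].
split; first by rewrite [size _]/= [X in _ + X]/=; lia.
by exists Q2, bad2; do 11 eexists; split; [reflexivity | exact: FI2 | exact: hb].
Qed.

(** The records are rebuilt in every round; only the copied input and the clear gaps have to survive
    a test. *)
Definition bisect_inv (n : nat) (rho : seq nat) (H : nat -> nat) :=
  exists lo s k bad i j src dst par tail head a b y d,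
    [/\ rho = frame lo s k bad i j src dst par tail head a b y d,
        input_copied h w x0 y0 P H, gaps_clear h w P H,
        (exists2 k, k <= lo + s & protectable h w x0 y0 k) /\ (forall k, k < lo -> ~ protectable h w x0 y0 k)
      & s < 2 ^ n].

Lemma bisect_body_correct n lo s k bad i j src dst par tail head a b y d H :
  input_copied h w x0 y0 P H -> gaps_clear h w P H ->
  (exists2 k, k <= lo + s & protectable h w x0 y0 k) -> (forall k, k < lo -> ~ protectable h w x0 y0 k) ->
  0 < s -> s < 2 ^ n.+1 ->
  terminates 25 (Seq (Blk [:: IHalf 8 8; IAdd 9 7 8])
    (Seq test_prog (IfNZ 10 (Blk [:: IAdd 7 9 3]) skip)))
    (frame lo s k bad i j src dst par tail head a b y d) H
    (fun t rho H' => t <= 180 * (h * w).+1 /\ bisect_inv n rho H').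
Proof.
move=> I G hi hlo s0 sn; apply: term_seq; apply: term_blk; first by [].
wp_run; apply: term_seq.
have T := @test_correct lo s./2 (lo + s./2) bad i j src dst par tail head a b y d H I G.
apply: (term_weaken T) => {T} t1 rho1 H1.
move=> [ht1 [Q [bad1 [i1 [j1 [src1 [dst1 [par1 [tail1 [head1 [a1 [b1 [y1 [d1 [-> FI hb]]]]]]]]]]]]]]].
have s2 : s./2 < 2 ^ n by move: sn; rewrite expnS; lia.
apply: term_if => //= r0; apply: term_blk => //=; split; try lia.
  have UB k' : k' <= lo + s./2 -> ~ protectable h w x0 y0 k'.
    by apply: (unprotectable h0 w1 (fi_uniq FI) (fi_in FI) (fi_order FI)); rewrite -hb.
  exists (lo + s./2 + 1), s./2, (lo + s./2), bad1, i1, j1, src1, dst1, par1, tail1, head1.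
  exists a1, b1, y1, d1; split => //; [exact: fi_input FI | exact: fi_gaps FI | split].
    by have [k' hk' pk'] := hi; exists k' => //; lia.
  by move=> k'; rewrite addn1 ltnS; apply: UB.
exists lo, s./2, (lo + s./2), bad1, i1, j1, src1, dst1, par1, tail1, head1.
exists a1, b1, y1, d1; split => //; [exact: fi_input FI | exact: fi_gaps FI | split => //].
exists (lo + s./2) => //; apply: (protectableP h0 w1 (fi_uniq FI) (fi_in FI)); last by rewrite -hb r0.
by move=> c Rc; rewrite (fi_mem FI) // -ltnNge.
Qed.

Lemma bisect_correct n s k bad i j src dst par tail head a b y d H :
  input_copied h w x0 y0 P H -> gaps_clear h w P H ->
  (exists2 k, k <= s & protectable h w x0 y0 k) -> s < 2 ^ n ->
  terminates 25 (Seq bisect (Blk [:: IAdd 0 7 23]))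
    (frame 0 s k bad i j src dst par tail head a b y d) H
    (fun t rho H' => t <= 184 * (h * w).+1 * n.+1 /\
       protectable h w x0 y0 (nth 0 rho 0) /\
       (forall k, k < nth 0 rho 0 -> ~ protectable h w x0 y0 k)).
Proof.
move=> I G hi sn; apply: term_seq.
have T : terminates 25 bisect (frame 0 s k bad i j src dst par tail head a b y d) H
    (fun t rho H' => t <= (180 * (h * w).+1).+2 * n.+1 /\ exists lo s k bad i j src dst par tail head a b y d,
        rho = frame lo s k bad i j src dst par tail head a b y d /\
        protectable h w x0 y0 lo /\ (forall k, k < lo -> ~ protectable h w x0 y0 k)).
  apply: (@term_while _ _ _ _ bisect_inv (180 * (h * w).+1)) => //; last first.
    by exists 0, s, k, bad, i, j, src, dst, par, tail, head, a, b, y, d; split.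
  move=> m rho H1 [lo1 [s1 [k1 [bad1 [i1 [j1 [src1 [dst1 [par1 [tail1 [head1]]]]]]]]]]].
  move=> [a1 [b1 [y1 [d1 [-> I1 G1 [hi1 hlo1] s1m]]]]]; split=> [r0|r0].
    have E : s1 = 0 by exact: r0.
    exists lo1, s1, k1, bad1, i1, j1, src1, dst1, par1, tail1, head1, a1, b1, y1, d1.
    split => //; split => //.
    have [k' hk' pk'] := hi1; case: (ltnP k' lo1) => [/hlo1//|hk].
    by have <- : k' = lo1 by lia.
  have s1p : 0 < s1 by rewrite lt0n.
  case: m s1m => [|m] s1m; first by move: s1m; rewrite expn0; lia.
  split => //; exact: bisect_body_correct.
apply: (term_weaken T) => {T} t rho H1.
move=> [ht [lo1 [s1 [k1 [bad1 [i1 [j1 [src1 [dst1 [par1 [tail1 [head1]]]]]]]]]]]].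
move=> [a1 [b1 [y1 [d1 [-> hlo]]]]]; apply: term_blk; first by [].
wp_run; rewrite addn0; split => //.
rewrite [size _]/=; apply: leq_trans (leq_add ht (leqnn 1)) _.
rewrite -[X in _ <= X]mulnA; nia.
Qed.

End Bisection.

(** * Freeing the registers *)

(** The copy starts at 25, since the words below have been saved to their new places and now serve
    as registers. *)
Definition copy_input : cmd :=
  Seq (Blk [:: IConst 2 25; IConst 3 1; IAdd 4 1 2])
      (While [:: ISub 5 1 2] 5 (Blk [:: ILoad 6 2; IStore 4 6; IAdd 2 2 3; IAdd 4 4 3])).

(** Register 1 has been turned from [w] into [P]. Counting [2 * h] down by halving again repeats the
    number of doublings that depends on [h]; seven more halvings remove the constant factor. *)
Definition recover_width : cmd :=
  Seq (Blk [:: IConst 23 0; IAdd 2 1 23; IAdd 3 0 0])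
  (Seq (While [::] 3 (Blk [:: IHalf 3 3; IHalf 2 2]))
       (Blk (nseq 7 (IHalf 2 2)))).

(** The first six instructions bring the parked resistance of cell [(0, 0)] back from the corner
    word to its own place in the copy. *)
Definition load_constants : cmd :=
  Blk [:: IAdd 6 1 2; IAdd 6 6 2; ILoad 7 6; IConst 8 2; IAdd 6 1 8; IStore 6 7;
         IConst 4 4; IAdd 5 2 3; IAdd 5 5 5; IAdd 5 5 5; IAdd 6 5 4; IConst 7 0;
         IAdd 22 1 1; IConst 24 3; IAdd 24 22 24; IConst 8 1; IConst 18 3; IAdd 18 1 18].

(** The scan covers the fuel words up to [2 * P], because words past the input are 0. Register 8
    starts at 1, so it ends with the value of [protectable_total]. *)
Definition sum_fuel : cmd :=
  While [:: ISub 19 22 18] 19 (Blk [:: ILoad 20 18; IAdd 8 8 20; IAdd 18 18 3; IAdd 18 18 3]).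

Ltac regs := do ?rewrite size_set_nth; do ?(rewrite nth_set_nth /=).

Section Setup.
Variables (h w : nat) (x0 y0 : nat -> nat -> nat).
Hypotheses (h0 : 0 < h) (w0 : 0 < w).

Definition bits := (trunc_log 2 (h + h)).+1.

Lemma bitsP i : ((h + h) %/ 2 ^ i == 0) = (bits <= i).
Proof.
have /andP[lo hi] := trunc_log_bounds (isT : 1 < 2) (ltn_addr h h0).
rewrite -leqn0 leqNgt divn_gt0 ?expn_gt0 // -ltnNge /bits.
by apply/idP/idP => H; [rewrite -(ltn_exp2l _ _ (isT : 1 < 2)) (leq_ltn_trans lo) |
  rewrite (leq_trans hi) // leq_exp2l].
Qed.

Lemma half_divn_exp a i : (a %/ 2 ^ i)./2 = a %/ 2 ^ i.+1.
Proof. by rewrite -divn2 -divnMA expnSr. Qed.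

(* All addresses from [P] on are free in the input, so it can be moved up by [P]. *)
Definition big_base := w * 2 ^ 7 * 2 ^ bits.
Local Notation P := big_base.

Lemma bits_bounds : h + h < 2 ^ bits <= 4 * h.
Proof.
have /andP[lo hi] := trunc_log_bounds (isT : 1 < 2) (ltn_addr h h0).
by rewrite /bits hi expnS; lia.
Qed.

Lemma base_lower : 128 * (h * w) + 2 * w + 64 <= P.
Proof. by rewrite /big_base; have /andP[] := bits_bounds; nia. Qed.

Lemma base_upper : P <= 512 * (h * w).
Proof. by rewrite /big_base; have /andP[] := bits_bounds; nia. Qed.

Lemma bits_le_base : bits <= P.
Proof.
by rewrite /big_base; apply: leq_trans (ltnW (ltn_expl bits (isT : 1 < 2))) _; rewrite leq_pmull //; lia.
Qed.

Variable J : nat -> nat.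

Definition reg_inv (n : nat) (rho : seq nat) := [/\ size rho = n, nth 0 rho 0 = h & nth 0 rho 1 = P].

Lemma copy_input_correct rho H : reg_inv 25 rho ->
  (forall a, 3 <= a < 25 -> H (P + a) = J a) ->
  (forall a, 25 <= a < P -> H a = J a) ->
  (forall a, P + 25 <= a -> H a = 0) ->
  terminates 25 copy_input rho H (fun t rho' H' => t <= 10 * P /\
    [/\ reg_inv 25 rho', nth 0 rho' 3 = 1,
        forall a, 3 <= a < P -> H' (P + a) = J a
      & forall a, 2 * P <= a -> H' a = 0]).
Proof.
move=> [sz r0 r1] Hlo Hmid Hhi; have := base_lower => PB.
apply: term_seq; apply: term_blk => //=.
pose I n (rho : seq nat) (H : nat -> nat) := exists c,
  [/\ reg_inv 25 rho, [/\ 25 <= c <= P, nth 0 rho 2 = c, nth 0 rho 3 = 1 & nth 0 rho 4 = P + c],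
    forall a, 3 <= a < c -> H (P + a) = J a,
    (forall a, 25 <= a < P -> H a = J a) /\ (forall a, P + c <= a -> H a = 0)
   & P - c <= n].
have T k rho1 H1 : I k rho1 H1 -> terminates 25
   (While [:: ISub 5 1 2] 5 (Blk [:: ILoad 6 2; IStore 4 6; IAdd 2 2 3; IAdd 4 4 3])) rho1 H1
   (fun t rho' H' => t <= (1 + 4).+2 * k.+1 /\ [/\ reg_inv 25 rho', nth 0 rho' 3 = 1,
        forall a, 3 <= a < P -> H' (P + a) = J a
      & forall a, 2 * P <= a -> H' a = 0]).
  apply: term_while => // {k rho1 H1} n rho1 H1 [c [[sz1 q0 q1] [hc q2 q3 q4] E1 [E2 E3] hn]].
  rewrite /= !nth_set_nth /= q1 q2; split=> Z.
    have cP : c = P by lia.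
    split; [|by []|by move=> a ha; apply: E1; lia|by move=> a ha; apply: E3; lia].
    by split; regs; rewrite ?sz1.
  split; first lia.
  apply: term_blk => //=; regs; rewrite sz1 q2 q3 q4.
  split; first lia.
  split; first lia.
  split => //; exists c.+1; split.
  - by split; regs; rewrite ?sz1.
  - by split; regs; rewrite ?q3; lia.
  - move=> a ha; case: (eqVneq a c) => [->|ac]; first by rewrite upd_eq E2 //; lia.
    by rewrite upd_neq ?E1 //; lia.
  - by split=> a ha; [rewrite upd_neq ?E2 // | rewrite upd_neq ?E3 //]; lia.
  lia.
apply: (term_weaken (T (P - 25) _ _ _)).
  exists 25; split => //.
  - by split; regs; rewrite ?sz.
  - by split; regs; rewrite ?r1; lia.
by move=> t rho' H' [ht HH]; split => //; lia.
Qed.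

Lemma recover_width_correct rho H : reg_inv 25 rho -> nth 0 rho 3 = 1 ->
  terminates 25 recover_width rho H (fun t rho' H' => t <= 5 * P + 100 /\
    H' = H /\ [/\ reg_inv 25 rho', nth 0 rho' 2 = w & nth 0 rho' 23 = 0]).
Proof.
move=> [sz r0 r1] r3; apply: term_seq; apply: term_blk => //=.
pose I n (rho : seq nat) (H' : nat -> nat) := exists i,
  [/\ H' = H, reg_inv 25 rho, i <= bits, bits - i <= n &
   [/\ nth 0 rho 2 = P %/ 2 ^ i, nth 0 rho 3 = (h + h) %/ 2 ^ i & nth 0 rho 23 = 0]].
have T k rho1 H1 : I k rho1 H1 -> terminates 25
   (While [::] 3 (Blk [:: IHalf 3 3; IHalf 2 2])) rho1 H1
   (fun t rho' H' => t <= (0 + 2).+2 * k.+1 /\ (H' = H /\ [/\ reg_inv 25 rho',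
      nth 0 rho' 2 = w * 2 ^ 7 & nth 0 rho' 23 = 0])).
  apply: term_while => // {k rho1 H1} n rho1 H1 [i [-> [sz1 q0 q1] hi hn [q2 q3 q23]]].
  have B : (nth 0 rho1 3 == 0) = (bits <= i) by rewrite q3 bitsP.
  rewrite /=; split=> Z; move: B; rewrite ?Z ?eqxx ?(negbTE Z) => B.
    have E : i = bits by lia.
    by split => //; split => //; rewrite q2 E /big_base mulnK ?expn_gt0.
  split; first lia.
  apply: term_blk => //=; split => //; exists i.+1; split => //; try lia.
  - by split; regs; rewrite ?sz1.
  by regs; rewrite q2 q3 q23 !half_divn_exp.
apply: term_seq; apply: (term_weaken (T bits _ _ _)).
  exists 0; split => //; try lia.
  - by split; regs; rewrite ?sz.
  by regs; rewrite r0 r1 addn0 expn0 !divn1.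
move=> t rho2 H2 [ht [-> [[sz2 q0 q1] q2 q23]]]; apply: term_blk => //=.
split; first by have := bits_le_base; lia.
split => //; split.
- by split; regs; rewrite ?sz2.
- by regs; rewrite q2; lia.
by regs.
Qed.

Hypotheses (w1 : 1 < w) (J_input : forall a, 3 <= a -> a != 2 * w -> J a = input h w x0 y0 a)
  (J_saved : J (2 * w) = input h w x0 y0 2).

Lemma input_x q : q < h * w -> input h w x0 y0 (2 + 2 * q) = x0 (q %/ w) (q %% w).
Proof.
move=> hq; rewrite /input; have -> : (2 + 2 * q == 0) = false by lia.
have -> : (2 + 2 * q == 1) = false by lia.
have -> : (2 + 2 * q - 2)./2 = q by lia.
by rewrite hq oddD oddM.
Qed.

Lemma input_y q : input h w x0 y0 (3 + 2 * q) = if q < h * w then y0 (q %/ w) (q %% w) else 0.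
Proof.
rewrite /input; have -> : (3 + 2 * q == 0) = false by lia.
have -> : (3 + 2 * q == 1) = false by lia.
have -> : (3 + 2 * q - 2)./2 = q by lia.
by rewrite oddD oddM.
Qed.

Lemma load_input H : (forall a, 3 <= a < P -> H (P + a) = J a) ->
  input_copied h w x0 y0 P (upd H (P + 2) (H (P + 2 * w))).
Proof.
have PB := base_lower.
move=> HJ i j hi hj; have hq := cell_index_lt hi hj.
have Eq : (i * w + j) %/ w = i by rewrite divnMDl // divn_small // addn0.
have Em : (i * w + j) %% w = j by rewrite modnMDl modn_small.
split=> [jw|]; last first.
  rewrite upd_neq; last by lia.
  rewrite -addnA HJ; last by lia.
  by rewrite J_input ?input_y ?hq ?Eq ?Em //; lia.
have Hx : x0 i j = input h w x0 y0 (2 + 2 * (i * w + j)) by rewrite input_x ?Eq ?Em.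
case: (posnP (i * w + j)) => [E|qp].
  by rewrite Hx E muln0 !addn0 upd_eq HJ ?J_saved //; lia.
rewrite upd_neq; last by lia.
rewrite -addnA HJ; last by lia.
rewrite J_input ?Hx //; first by lia.
(* The address [2 + 2 * q] equals [2 * w] only for the corner [(0, w - 1)], which [jw] excludes. *)
case: i hi hq Eq Em Hx qp => [|i] *; lia.
Qed.

Lemma total_fuelE : total_fuel h w y0 = \sum_(q < h * w) y0 (q %/ w) (q %% w).
Proof.
rewrite -(big_mkord xpredT (fun q => y0 (q %/ w) (q %% w))) /index_iota subn0.
rewrite -(big_map (fun q => (q %/ w, q %% w)) xpredT (fun c => y0 c.1 c.2)).
apply: perm_big; apply: uniq_perm; first exact: uniq_cells.
  rewrite map_inj_in_uniq ?iota_uniq // => q r _ _ [E1 E2].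
  by rewrite (divn_eq q w) (divn_eq r w) E1 E2.
move=> [i j]; rewrite mem_cells; apply/idP/mapP => [/andP[/= hi hj]|[q]].
  exists (i * w + j); first by rewrite mem_iota add0n; apply: cell_index_lt.
  by rewrite divnMDl // divn_small // addn0 modnMDl modn_small.
rewrite mem_iota add0n /= => hq [-> ->]; rewrite /in_R /= ltn_divLR // hq.
exact: ltn_pmod.
Qed.

Lemma sum_fuel_correct rho H : size rho = 25 -> nth 0 rho 3 = 1 -> nth 0 rho 8 = 1 ->
  nth 0 rho 18 = P + 3 -> nth 0 rho 22 = 2 * P ->
  (forall a, 3 <= a < P -> H (P + a) = J a) ->
  terminates 25 sum_fuel rho H (fun t rho' H' => t <= 10 * P /\
    [/\ H' = H, nth 0 rho' 8 = (total_fuel h w y0).+1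
      & forall i, i \notin [:: 8; 18; 19; 20] -> nth 0 rho' i = nth 0 rho i] /\ size rho' = 25).
Proof.
move=> sz r3 r8 r18 r22 HJ; have PB := base_lower.
pose P2 := w * 2 ^ 6 * 2 ^ bits.
have EP : P = 2 * P2 by rewrite /big_base /P2 (expnS 2 6); lia.
pose F q := J (3 + 2 * q).
pose I n (rho' : seq nat) (H' : nat -> nat) := exists m,
  [/\ H' = H, size rho' = 25, P2 - m <= n /\ m.+1 <= P2,
     nth 0 rho' 18 = P + 3 + 2 * m /\ nth 0 rho' 8 = (\sum_(q < m) F q).+1
   & forall i, i \notin [:: 8; 18; 19; 20] -> nth 0 rho' i = nth 0 rho i].
have FE q : F q = if q < h * w then y0 (q %/ w) (q %% w) else 0.
  (* Fuel sits at odd addresses, while the overwritten one is even. *)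
  by rewrite /F J_input ?input_y //; lia.
have total : \sum_(q < P2.-1) F q = total_fuel h w y0.
  rewrite total_fuelE -(big_mkord xpredT F) (@big_cat_nat _ _ _ (h * w)) //=; last by lia.
  rewrite [X in _ + X]big_nat_cond [X in _ + X]big1 ?addn0 => [|q /andP[/andP[hq _] _]].
    by rewrite big_mkord; apply: eq_bigr => q _; rewrite FE ltn_ord.
  by rewrite FE ltnNge hq.
have T : terminates 25 sum_fuel rho H (fun t rho' H' => t <= (1 + 4).+2 * P2.+1 /\
    ([/\ H' = H, nth 0 rho' 8 = (total_fuel h w y0).+1
      & forall i, i \notin [:: 8; 18; 19; 20] -> nth 0 rho' i = nth 0 rho i] /\ size rho' = 25)).
  apply: (@term_while _ _ _ _ I 4) => //; last first.
    by exists 0; rewrite big_ord0 addn0; split => //; lia.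
  move=> n rho1 H1 [m [-> sz1 [hn hm] [q18 q8] hq]].
  have q22 : nth 0 rho1 22 = 2 * P by rewrite hq.
  have q3 : nth 0 rho1 3 = 1 by rewrite hq.
  rewrite /=; regs; rewrite q22 q18; split=> Z.
    have mP : m = P2.-1 by lia.
    split; last by regs; rewrite sz1.
    split => //; first by regs; rewrite q8 mP total.
    by move=> i hi; rewrite nth_set_nth /=; case: eqP hi => [->//|_]; apply: hq.
  split; first lia.
  apply: term_blk => //=; regs; rewrite q18 q8 q3 sz1; split; first lia.
  split => //; exists m.+1; split => //.
  - by regs; rewrite sz1.
  - by lia.
  - regs; split; first by lia.
    by rewrite big_ord_recr /= -addnA HJ ?addSn //; lia.
  move=> i hi; do 5! (rewrite nth_set_nth /=; case: eqP hi => [->//|_ hi]).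
  exact: hq.
by apply: (term_weaken T) => t rho' H' [ht HH]; split => //; lia.
Qed.

End Setup.

Definition main_phase : cmd :=
  Seq copy_input (Seq recover_width (Seq (Blk [:: IConst 3 1; ISub 5 2 3])
  (IfNZ 5 (Seq load_constants (Seq sum_fuel (Seq bisect (Blk [:: IAdd 0 7 23])))) skip))).

(** Spelling out an abstract register list makes [wp] compute on it. *)
Lemma regs_literal rho : size rho = 25 -> exists2 z : nat -> nat,
  rho = [:: z 0; z 1; z 2; z 3; z 4; z 5; z 6; z 7; z 8; z 9; z 10; z 11; z 12; z 13; z 14;
            z 15; z 16; z 17; z 18; z 19; z 20; z 21; z 22; z 23; z 24]
  & forall i, z i = nth 0 rho i.
Proof.
by move=> sz; exists (nth 0 rho) => //; rewrite -[LHS](mkseq_nth 0) sz.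
Qed.

Section Main.
Variables (h w : nat) (x0 y0 : nat -> nat -> nat).
Hypotheses (h0 : 0 < h) (w0 : 0 < w).
Local Notation P := (big_base h w).

Definition minimal_protection (k : nat) := protectable h w x0 y0 k /\
  forall k', k' < k -> ~ protectable h w x0 y0 k'.

Definition rounds := (trunc_log 2 (total_fuel h w y0).+1).+1.

Variable J : nat -> nat.
Hypotheses (J_input : forall a, 3 <= a -> a != 2 * w -> J a = input h w x0 y0 a)
  (J_saved : 1 < w -> J (2 * w) = input h w x0 y0 2).

Lemma solve_correct rho H : 1 < w -> reg_inv h w 25 rho -> nth 0 rho 2 = w ->
  nth 0 rho 3 = 1 -> nth 0 rho 23 = 0 ->
  (forall a, 3 <= a < P -> H (P + a) = J a) -> (forall a, 2 * P <= a -> H a = 0) ->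
  terminates 25 (Seq load_constants (Seq sum_fuel (Seq bisect (Blk [:: IAdd 0 7 23])))) rho H
    (fun t rho' H' => t <= 11 * P + 184 * (h * w).+1 * rounds.+1 /\
       minimal_protection (nth 0 rho' 0)).
Proof.
move=> w1 [sz r0 r1] r2 r3 r23 HJ Hhi.
have PB := base_lower h0 w0.
apply: term_seq; apply: term_blk; first by [].
have [z Ez Hz] := regs_literal sz; rewrite Ez.
have [z0 z1 z2 [z3 z23]] : [/\ z 0 = h, z 1 = P, z 2 = w & z 3 = 1 /\ z 23 = 0].
  by rewrite !Hz.
wp_run; rewrite z0 z1 z2 z3 z23.
split; first lia.
split; first lia.
have -> : P + P = 2 * P by lia.
have -> : P + w + w = P + 2 * w by lia.
apply: term_seq.
set H2 := upd _ _ _.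
have HJ2 a : 3 <= a < P -> H2 (P + a) = J a.
  by move=> ha; rewrite /H2 upd_neq ?HJ //; lia.
have I2 : input_copied h w x0 y0 P H2.
  exact: (load_input h0 w0 w1 J_input (J_saved w1) HJ).
have G2 : gaps_clear h w P H2.
  by move=> g _; rewrite /H2 upd_neq ?Hhi //; lia.
set rho0 := (X in terminates _ _ X).
have T := @sum_fuel_correct h w x0 y0 h0 w0 J w1 J_input (J_saved w1) rho0 H2.
apply: (term_weaken (T _ _ _ _ _ HJ2)) => {T} // t1 rho1 H1.
move=> [ht1 [[-> s8 sE] sz1]].
have [u Eu Hu] := regs_literal sz1.
have F i v : i \notin [:: 8; 18; 19; 20] -> nth 0 rho0 i = v -> u i = v.
  by move=> hi <-; rewrite Hu sE.
have u8 : u 8 = (total_fuel h w y0).+1 by rewrite Hu.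
have E : rho1 = frame h w P 0 (total_fuel h w y0).+1 (u 9) (u 10) (u 11) (u 12) (u 13) (u 14)
    (u 15) (u 16) (u 17) (u 18) (u 19) (u 20) (u 21).
  rewrite Eu u8 (F 0 h) // (F 1 P) // (F 2 w) // (F 3 1) // (F 4 4) // (F 7 0) //.
  rewrite (F 5 (4 * w.+1)) //; last by rewrite /rho0 /=; lia.
  rewrite (F 6 (4 * w.+2)) //; last by rewrite /rho0 /=; lia.
  by rewrite (F 22 (2 * P)) // (F 23 0) // (F 24 (2 * P + 3)).
rewrite E.
have PI : 2 * (h * w) + 2 <= P by lia.
have P64 : 64 <= P by lia.
have T := @bisect_correct h w x0 y0 P h0 w1 P64 PI rounds (total_fuel h w y0).+1 (u 9) (u 10)
  (u 11) (u 12) (u 13) (u 14) (u 15) (u 16) (u 17) (u 18) (u 19) (u 20) (u 21) H2 I2 G2.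
apply: (term_weaken (T _ _)) => {T}.
- by exists (total_fuel h w y0).+1 => //; apply: protectable_total.
- exact: trunc_log_ltn.
move=> t2 rho2 H3 [ht2 hmin]; split => //.
by rewrite [size _]/=; lia.
Qed.

Lemma main_phase_correct rho H : reg_inv h w 25 rho ->
  (forall a, 3 <= a < 25 -> H (P + a) = J a) ->
  (forall a, 25 <= a < P -> H a = J a) ->
  (forall a, P + 25 <= a -> H a = 0) ->
  terminates 25 main_phase rho H (fun t rho' H' => t <= 30 * P + (1 < w) * (184 * (h * w).+1 * rounds.+1) /\
       (1 < w -> minimal_protection (nth 0 rho' 0))).
Proof.
move=> R Hlo Hmid Hhi; have PB := base_lower h0 w0; apply: term_seq.
apply: (term_weaken (copy_input_correct h0 w0 R Hlo Hmid Hhi)) => t1 rho1 H1 [ht1 [R1 q3 E1 E2]].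
apply: term_seq.
apply: (term_weaken (@recover_width_correct h w h0 w0 rho1 H1 R1 q3)).
move=> t2 rho2 _ [ht2 [-> [[sz2 p0 p1] p2 p23]]].
apply: term_seq; apply: term_blk => //=.
apply: term_if => // r5; last first.
  apply: term_blk => //=; split; first by lia.
  by move: r5; regs; rewrite p2; lia.
have w1 : 1 < w by move: r5; regs; rewrite p2; lia.
set rho3 := set_nth _ _ _ _.
have R3 : reg_inv h w 25 rho3 by split; rewrite /rho3; regs; rewrite ?sz2.
have T := @solve_correct rho3 H1 w1 R3.
apply: (term_weaken (T _ _ _ E1 E2)) => {T}; try by rewrite /rho3; regs.
by move=> t3 rho4 H4 [ht3 hm]; split => //; lia.
Qed.

End Main.

(** * Starting with three registers *)

Definition find_base : cmd :=
  Seq (Blk [:: IAdd 1 1 1]) (Seq (Blk [:: IStore 1 2]) (Seq (Blk [:: IAdd 2 0 0])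
  (Seq (While [::] 2 (Blk [:: IHalf 2 2; IAdd 1 1 1])) (Blk (nseq 6 (IAdd 1 1 1)))))).

Definition save_instrs (l : seq nat) : seq instr :=
  flatten [seq [:: IConst 2 a; IAdd 2 1 2; IStore 2 a] | a <- l].

Definition program : cmd :=
  IfNZ 0 (IfNZ 1 (Seq find_base (Seq (Blk (save_instrs (iota 3 22))) main_phase)) skip) skip.

(** This is the passage from 3 to 25 registers: the words saved here are heap before and registers
    afterwards, so the claim is about raw memory. Address 2 is scratch and therefore excluded. *)
Lemma save_effect P m l : 64 <= P -> m 1 = P -> all (fun a => 2 < a < 25) l ->
  forall b, b != 2 -> foldl effect m (save_instrs l) b =
    if (P <= b) && (b - P \in l) then m (b - P) else m b.
Proof.
move=> hP; elim: l m => [|a l IH] m m1; first by move=> _ b _; rewrite andbF.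
rewrite [all _ _]/= => /andP[ha hl] b hb.
rewrite [foldl _ _ _]/= -/(save_instrs l).
set m' := upd _ _ _.
have E c : c != 2 -> m' c = if c == P + a then m a else m c.
  move=> hc; rewrite /m' /upd /=; have -> : (a == 2) = false by lia.
  by rewrite m1 (negbTE hc).
have m'1 : m' 1 = P by rewrite E //; case: eqP => //; lia.
rewrite IH // (E b hb) in_cons.
have Em c : 2 < c < 25 -> m' c = m c.
  by move=> hc; rewrite E; [case: eqP => //; lia | lia].
case: (eqVneq b (P + a)) => [->|N].
  by rewrite leq_addr addKn eqxx /= Em // if_same.
case: (leqP P b) => //= hPb; rewrite (_ : (b - P == a) = false) /=; last by lia.
by case: ifP => // /(allP hl) /= h2; rewrite Em.
Qed.

Lemma straight_save l : all straight (save_instrs l).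
Proof. by elim: l. Qed.

Section Total.
Variables (h w : nat) (x0 y0 : nat -> nat -> nat).
Hypotheses (h0 : 0 < h) (w0 : 0 < w).
Local Notation P := (big_base h w).
Local Notation inp := (input h w x0 y0).

(* The cell at address [2 * w], in the lower right corner, starts on fire: its resistance
   is irrelevant, so a register can be saved there (unless [w = 1], when the two coincide). *)
Definition saved_input : nat -> nat := if w == 1 then inp else upd inp (2 * w) (inp 2).

(** [wp] rejects stores into registers. For [w = 1] the parking store hits address 2 itself and
    writes back the value already there. *)
Lemma term_store_self n a r rho H Q : a < n -> r < n ->
  nth 0 rho a = r -> Q 1 rho H -> terminates n (Blk [:: IStore a r]) rho H Q.
Proof.
move=> ha hr E q sz m Em; exists (upd m (m a) (m r)), 1, rho, H; split => //.
  exact: (@RunBlk [:: IStore a r]).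
move=> b; rewrite /upd; case: eqP => [->|_]; last exact: Em.
by rewrite -!Em (Em a) flat_reg ?sz // E.
Qed.

Lemma find_base_correct :
  terminates 3 find_base [:: h; w; inp 2] inp (fun t rho' H' =>
    t <= 5 * P + 20 /\ H' = saved_input /\ reg_inv h w 3 rho').
Proof.
have PB := base_lower h0 w0.
apply: term_seq; apply: term_blk => //=; apply: term_seq.
have T1 : terminates 3 (Blk [:: IStore 1 2]) [:: h; w + w; inp 2] inp
    (fun t rho H => t = 1 /\ rho = [:: h; w + w; inp 2] /\ H = saved_input).
  rewrite /saved_input; case: eqP => [->|w1]; first exact: term_store_self.
  by apply: term_blk => //=; split; [lia | rewrite addnn -mul2n].
apply: (term_weaken T1) => {T1} _ _ _ [-> [-> ->]].
apply: term_seq; apply: term_blk => //=; apply: term_seq.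
pose I n (rho : seq nat) (H : nat -> nat) := exists i,
  [/\ H = saved_input, rho = [:: h; 2 * w * 2 ^ i; (h + h) %/ 2 ^ i], i <= bits h & bits h - i <= n].
have T : terminates 3 (While [::] 2 (Blk [:: IHalf 2 2; IAdd 1 1 1])) [:: h; w + w; h + h] saved_input
    (fun t rho H => t <= (0 + 2).+2 * (bits h).+1 /\
       (H = saved_input /\ rho = [:: h; 2 * w * 2 ^ bits h; 0])).
  apply: (@term_while _ _ _ _ I 2) => //; last first.
    by exists 0; rewrite expn0 muln1 divn1 subn0; split => //; rewrite mul2n addnn.
  move=> n rho H [i [-> -> hi hn]].
  have B := bitsP h0 i; rewrite /=; split=> Z; move: B; rewrite ?Z ?eqxx ?(negbTE Z) => B.
    by have -> : i = bits h by lia.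
  split; first lia.
  apply: term_blk => //=; split => //; exists i.+1; split => //; try lia.
  by rewrite half_divn_exp expnS; congr [:: _, _ & _]; lia.
apply: (term_weaken T) => {T} t _ _ [ht [-> ->]].
apply: term_blk => //=; split; first by have := bits_le_base h0 w0; lia.
by split => //; split => //=; rewrite /big_base; lia.
Qed.

Lemma program_correct : exists m t,
  [/\ run program inp m t, t <= 40 * P + 200 + (1 < w) * (184 * (h * w).+1 * (rounds h w y0).+1)
    & 1 < w -> minimal_protection h w x0 y0 (m 0)].
Proof.
have PB := base_lower h0 w0.
have Ei : inp =1 flat ([:: h; w; inp 2], inp) by move=> [|[|[|a]]].
have [m1 [t1 [rho1 [H1 [R1 E1 sz1 [ht1 [EH [_ r0 r1]]]]]]]] := find_base_correct (erefl 3) Ei.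
subst H1.
have m1_0 : m1 0 = h by rewrite E1 flat_reg ?sz1.
have m1_1 : m1 1 = P by rewrite E1 flat_reg ?sz1.
have m1_hi a : 3 <= a -> m1 a = saved_input a by move=> ha; rewrite E1 flat_heap ?sz1.
pose m2 := foldl effect m1 (save_instrs (iota 3 22)).
have P64 : 64 <= P by lia.
have m2E b : b != 2 -> m2 b = if (P <= b) && (b - P \in iota 3 22) then m1 (b - P) else m1 b.
  by apply: save_effect.
have E2 : m2 =1 flat (mkseq m2 25, m2).
  by move=> a; rewrite /flat size_mkseq /=; case: ltnP => // ha; rewrite (nth_mkseq 0 m2 ha).
have J_input a : 3 <= a -> a != 2 * w -> saved_input a = inp a.
  by move=> _ ha; rewrite /saved_input; case: ifP => // _; rewrite upd_neq //; apply/eqP.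
have J_saved : 1 < w -> saved_input (2 * w) = inp 2.
  by move=> w1; rewrite /saved_input (_ : (w == 1) = false) ?upd_eq //; lia.
have R2 : reg_inv h w 25 (mkseq m2 25).
  split; first by rewrite size_mkseq.
  - by rewrite nth_mkseq // m2E // m1_0 (_ : (P <= 0) = false) //; lia.
  - by rewrite nth_mkseq // m2E // m1_1 (_ : (P <= 1) = false) //; lia.
have T := @main_phase_correct h w x0 y0 h0 w0 saved_input J_input J_saved _ m2 R2.
have [||||m3 [t3 [rho3 [H3 [R3 E3 sz3 [ht3 hm]]]]]] := T _ _ _ _ _ E2.
- move=> a ha; rewrite m2E; last by lia.
  by rewrite leq_addr addKn mem_iota (_ : (_ <= a < _) = true) ?m1_hi //; lia.
- move=> a ha; rewrite m2E; last by lia.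
  rewrite (_ : (P <= a) = false) /=; last by lia.
  by rewrite m1_hi //; lia.
- move=> a ha; rewrite m2E; last by lia.
  rewrite mem_iota (_ : (_ < 3 + 22) = false); last by lia.
  rewrite andbF andbF m1_hi; last by lia.
  rewrite J_input; try lia.
  rewrite /input; have -> : (a == 0) = false by lia.
  have -> : (a == 1) = false by lia.
  by have -> : ((a - 2)./2 < h * w) = false by lia.
- by rewrite size_mkseq.
exists m3, (t1 + (size (save_instrs (iota 3 22)) + t3)).+4; split.
- apply: RunThen; first by rewrite /input /= -lt0n.
  apply: RunThen; first by rewrite /input /= -lt0n.
  apply: RunSeq R1 _; apply: RunSeq _ R3; apply: RunBlk; exact: straight_save.
- by rewrite [size _]/=; lia.
by move=> w1; rewrite E3 flat_reg ?sz3 //; apply: hm.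
Qed.

End Total.

(** In a single column the village is the right boundary and is ignited at time 0, so no path
    protects it. *)
Lemma protecting_path_dims h w x0 y0 k p :
  protecting_path h w x0 y0 k p -> 0 < h /\ 1 < w.
Proof.
move=> [[c0 [p' [-> [/= /andP[/andP[hc wc] _] [_ [c00 _]]]]]] safe].
have h0 : 0 < h by lia.
split => //; rewrite ltnNge; apply/negP => w1; apply: (safe 0 h0).
by left; rewrite /=; lia.
Qed.

Lemma rounds_bound h w y0 : 0 < h -> 1 < w ->
  rounds h w y0 <= trunc_log 2 (h * w) + trunc_log 2 (Ymax h w y0) + 3.
Proof.
move=> h0 w1; rewrite /rounds.
have L := total_fuel_le y0 h0 w1.
have B1 := trunc_log_ltn (h * w) (isT : 1 < 2).
have B2 := trunc_log_ltn (Ymax h w y0) (isT : 1 < 2).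
set a := trunc_log 2 _ in B1 *; set b := trunc_log 2 _ in B2 *.
have : (total_fuel h w y0).+1 <= 2 ^ (a.+1 + b.+1) by rewrite expnD; nia.
by move/(leq_trunc_log 2); rewrite trunc_expnK //; lia.
Qed.

Theorem theorem1 :
  exists (prog : seq instr) (C : nat),
  forall (h w : nat) (x0 y0 : nat -> nat -> nat),
  exists (T : nat) (m : nat -> nat),
    T <= C * (h * w).+1 * (trunc_log 2 (h * w)).+1
           * (trunc_log 2 (Ymax h w y0)).+1 /\
    exec prog T 0 (input h w x0 y0) = Some m /\
    ((exists k p, protecting_path h w x0 y0 k p) ->
       (exists p, protecting_path h w x0 y0 (m 0) p) /\
       (forall k p, protecting_path h w x0 y0 k p -> m 0 <= k)).
Proof.
exists (compile program 0), (40 * 1000) => h w x0 y0; set C := 40 * 1000.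
set n := h * w; set a := trunc_log 2 n; set b := trunc_log 2 _.
suff [m [t [R tle min]]] : exists m t, [/\ run program (input h w x0 y0) m t,
    t.+1 <= C * (n.+1 * (a.+1 * b.+1))
  & 0 < h -> 1 < w -> minimal_protection h w x0 y0 (m 0)].
  exists t.+1, m; split; first by rewrite !mulnA in tle.
  split; first exact: exec_run R.
  move=> [k [p /protecting_path_dims[h0 w1]]]; have [pm mm] := min h0 w1.
  split => // k' p' pp; rewrite leqNgt; apply/negP => /mm; apply.
  by exists p'.
have B0 : 0 < n.+1 * (a.+1 * b.+1) by [].
case: (posnP h) => [->|h0].
  exists (input 0 w x0 y0), (0.+1); split => //; last by rewrite /C; lia.
  exact: (RunElse _ _ (@RunBlk [::] _ isT)).
case: (posnP w) => [w00|w0].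
  exists (input h w x0 y0), (0.+3); split => //; last 2 first.
  - by rewrite /C; lia.
  - by rewrite w00.
  by apply: RunThen; [rewrite -lt0n | exact: (RunElse _ _ (@RunBlk [::] _ isT))].
have [m [t [R tle min]]] := @program_correct h w x0 y0 h0 w0.
have BU := base_upper h0 w0.
exists m, t; split => //.
set N := a.+1 * b.+1; have N0 : 0 < N by [].
(* By [base_upper], [40 * P] is at most [20480 * n], which with the 200 stays below the first term.
   The factor 4 comes from [a + b + 4 <= 4 * N]. *)
have tle1 : t <= 21 * 1000 * n.+1 + (1 < w) * (184 * n.+1 * (4 * N)).
  apply: leq_trans tle _; apply: leq_add; first by rewrite /n; lia.
  case: (ltnP 1 w) => // w1; rewrite !mul1n leq_mul2l.
  have := rounds_bound y0 h0 w1; rewrite -/n -/a -/b /N; nia.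
have tle2 : t <= 21 * 1000 * n.+1 * N + 184 * n.+1 * (4 * N).
  apply: leq_trans tle1 (leq_add _ _); first by rewrite leq_pmulr.
  by case: (1 < w); rewrite ?mul1n.
by move: tle2; rewrite /C; rewrite -/N; move: (n.+1) (ltn0Sn n) => n' n0'; nia.
Qed.
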